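(* Consider an exponential family on a separable metric space $(\Omega,d)$ in natural parametrization, with densities $p_\eta(x)=h(x)\exp\{\eta^\top T(x)-A(\eta)\}$, $\eta\in\mathcal H$, with respect to a common dominating measure $\nu$, where the natural parameter space $\mathcal H\subset\mathbb R^p$ is open, $T:\Omega\to\mathbb R^p$ is measurable, $A:\mathcal H\to\mathbb R$, and the Fisher information matrix $\mathcal I_\eta=\partial^2A(\eta)/(\partial\eta\,\partial\eta^\top)$ is non-singular. Let $X_1,\ldots,X_n$ be iid from this family with true parameter $\eta_0\in\mathcal H$, and let $\hat\eta$ be the maximum likelihood estimator of $\eta_0$. Then $$\sqrt n(\hat\eta-\eta_0)=\mathcal I_{\eta_0}^{-1}\frac1{\sqrt n}\sum_{i=1}^n\Big(T(X_i)-\frac{\partial}{\partial\eta}A(\eta_0)\Big)+o_{\mathsf P}(1).$$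
   Context: $\frac{\partial}{\partial\eta}A(\eta_0)$ denotes the gradient of $A$ at $\eta_0$, and $A$ is the log-normalizer, so that $\int p_\eta\,\mathrm d\nu=1$ for every $\eta\in\mathcal H$. *)

(* Defs.v *)
From HB Require Import structures.
From mathcomp Require Import all_boot all_order all_algebra.
From mathcomp Require Import finmap.
From mathcomp Require Import all_classical all_reals all_analysis.
Set Implicit Arguments.
Unset Strict Implicit.
Unset Printing Implicit Defensive.
Import Order.TTheory GRing.Theory Num.Theory.
Import numFieldNormedType.Exports.
Local Open Scope classical_set_scope.
Local Open Scope ring_scope.

(* Measurable types of the library are pointed, hence nonempty.  For a sample
   space this is no restriction, since it carries a probability. *)
#[short(type="pmetricType")]
HB.structure Definition PointedMetric (R : numDomainType) :=
  {T of Pointed T & Metric R T}.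

Notation borelType T := (g_sigma_algebraType (@open T)).

Definition separable (T : topologicalType) : Prop :=
  exists2 S : set T, countable S & dense S.

Section calculus.
Context {R : realType} {p : nat}.
Implicit Types (A : 'cV[R]_p -> R) (eta : 'cV[R]_p).

Definition partial (i : 'I_p) A eta : R := 'D_(delta_mx i 0) A eta.

Definition gradient A eta : 'cV[R]_p := \col_i partial i A eta.

Definition hessian A eta : 'M[R]_p :=
  \matrix_(i, j) partial i (partial j A) eta.

End calculus.

Section exponential_family.
Context {R : realType} {Omega : pmetricType R} {p : nat}.
Variables (nu : {measure set (borelType Omega) -> \bar R}) (H : set 'cV[R]_p)
  (h : Omega -> R) (T : Omega -> 'cV[R]_p) (A : 'cV[R]_p -> R).

Definition exp_density (eta : 'cV[R]_p) (x : Omega) : R :=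
  h x * expR ((eta^T *m T x) 0 0 - A eta).

(* [A] is a total function, but only its values on the open set [H] matter. *)
Record exp_family : Prop := ExpFamily {
  ef_open : open H ;
  ef_h_meas : measurable_fun [set: borelType Omega] (h : borelType Omega -> R) ;
  ef_h_ge0 : forall x, 0 <= h x ;
  ef_T_meas : measurable_fun [set: borelType Omega]
    (T : borelType Omega -> borelType 'cV[R]_p) ;
  ef_normalized : forall eta, H eta ->
    (\int[nu]_x (exp_density eta x)%:E = 1)%E ;
}.

Definition fisher_information (eta : 'cV[R]_p) : 'M[R]_p := hessian A eta.

Definition likelihood (n : nat) (x : 'I_n -> Omega) (eta : 'cV[R]_p) : R :=
  \prod_(i < n) exp_density eta (x i).

Definition likelihood_maximizer (n : nat) (x : 'I_n -> Omega)
    (eta : 'cV[R]_p) : Prop :=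
  H eta /\ forall eta', H eta' -> likelihood x eta' <= likelihood x eta.

End exponential_family.

Section sampling.
Context {R : realType} {d : measure_display} {W : measurableType d}
  {P : probability W R}.

Definition mutually_independent {d' : measure_display} {S : measurableType d'}
    (X : nat -> {RV P >-> S}) : Prop :=
  forall (J : {fset nat}) (B : nat -> set S),
    (forall j, measurable (B j)) ->
    P (\bigcap_(j in [set` J]) (X j @^-1` B j)) =
      (\prod_(j <- J) P (X j @^-1` B j))%E.

(* [X i] stands for the observation usually numbered [i + 1]. *)
Definition iid_with_density {d' : measure_display} {S : measurableType d'}
    (nu : {measure set S -> \bar R}) (f : S -> R)
    (X : nat -> {RV P >-> S}) : Prop :=
  mutually_independent X /\
  forall i (B : set S), measurable B ->
    distribution P (X i) B = (\int[nu]_(x in B) (f x)%:E)%E.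

(* On samples for which the likelihood has no maximizer (e.g. a Bernoulli
   sample consisting of zeros only), the estimator is left unconstrained. *)
Definition is_mle {Omega : pmetricType R} {p : nat} (H : set 'cV[R]_p)
    (h : Omega -> R) (T : Omega -> 'cV[R]_p) (A : 'cV[R]_p -> R)
    (X : nat -> {RV P >-> borelType Omega})
    (etahat : nat -> {RV P >-> borelType 'cV[R]_p}) : Prop :=
  forall (n : nat) (w : W),
    let x := fun i : 'I_n => X i w : Omega in
    (exists eta, likelihood_maximizer H h T A x eta) ->
    likelihood_maximizer H h T A x (etahat n w).

(* [`| _ |] is the maximum norm of a vector. *)
Definition oP1 {p : nat} (r : nat -> W -> 'cV[R]_p) : Prop :=
  forall eps : R, 0 < eps ->
    P [set w | eps < `|r n w|] @[n --> \oo] --> 0%E.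

End sampling.

(* Main.v *)
Require Import Defs.
From HB Require Import structures.
From mathcomp Require Import all_boot all_order all_algebra.
From mathcomp Require Import finmap.
From mathcomp Require Import all_classical all_reals all_analysis.
From mathcomp Require Import measurable_realfun ring lra.
Set Implicit Arguments.
Unset Strict Implicit.
Unset Printing Implicit Defensive.
Import Order.TTheory GRing.Theory Num.Theory.
Import numFieldNormedType.Exports.
Local Open Scope classical_set_scope.
Local Open Scope ring_scope.

(** The likelihood of a sample is, up to a factor that does not depend on the
    parameter, [expR (n * J eta)] with [J eta = dot eta tau - A eta] and [tau]
    the mean of the observed statistics.  So the estimator maximizes a concave
    function which differs from its population version only through [tau], and
    the theorem says that its maximizer is, up to [o (1 / sqrt n)], that of the
    quadratic Taylor polynomial at [eta0].  The argument is the convexity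
    argument of Hjort and Pollard.

    Regularity.  Since [H] is open, the statistic [T] has exponential moments at
    every parameter of [H] ([exp_norm_integrable]), and
    [expR (A (eta + v) - A eta)] is the moment generating function of [T] at
    [v].  Bounding the remainder of the exponential series inside the integral
    gives [A (eta + v) = A eta + dot v m + dot v (V *m v) / 2 + O(`|v| ^ 3)],
    with [m] and [V] the mean and covariance of [T]
    ([log_normalizer_taylor2]), and [V] is the derivative of the mean
    ([mean_taylor1]).  Therefore the gradient and the hessian of [A] are [m] and
    [V], and a nonsingular covariance is coercive
    ([psd_unitmx_coercive]).

    Localization.  The maximizer of the quadratic polynomial is
    [eta0 + vs] with [V *m vs = tau - m].  On a sphere of radius [e]
    around it the objective lies below its value at the centre by the quadratic
    gap minus cubic remainders.  Convexity of [A] along segments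
    ([log_normalizer_convex]) propagates this to all parameters outside the
    sphere, near or far: a maximizer over [H] exists, and all of them lie in the
    ball ([tilted_argmax_exists], [tilted_argmax_near]).  With
    [tau - m = u / sqrt n] and [e = eps / sqrt n], this holds for all large [n],
    uniformly for [u] in a bounded set ([maximizer_near_newton_step]).

    Probability.  It remains to know that the normalised score
    [u = sqrt n *: (tau - m)] is bounded in probability.  Its coordinates have
    a variance that does not depend on [n], because the observations are
    pairwise uncorrelated, and Chebyshev's inequality concludes
    ([score_sum_tail]). *)

(** * Bounds on the exponential and the logarithm *)

Section real_bounds.
Context {R : realType}.
Implicit Types x y t : R.

Lemma series_exp_coeff_le n x : 0 <= x -> series (exp_coeff x) n <= expR x.
Proof.
move=> x0; apply: nondecreasing_cvgn_le; last exact: is_cvg_series_exp_coeff.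
apply/nondecreasing_seqP => k; rewrite /series/= big_nat_recr//= lerDl.
exact: exp_coeff_ge0.
Qed.

Lemma expr_le_expR n x : 0 <= x -> x ^+ n <= n`!%:R * expR x.
Proof.
move=> x0; rewrite mulrC -ler_pdivrMr ?ltr0n ?fact_gt0//.
apply: le_trans (series_exp_coeff_le n.+1 x0).
rewrite /series/= big_nat_recr//= lerDr.
by apply: sumr_ge0 => i _; exact: exp_coeff_ge0.
Qed.

(** The tail of the exponential series has a factor [x ^+ m], and what is left
    is dominated by the series of [expR `|x|] because [(i + m)`! >= i`!]. *)
Lemma expR_taylor_bound m x :
  `|expR x - \sum_(0 <= k < m) x ^+ k / k`!%:R| <= `|x| ^+ m * expR `|x|.
Proof.
pose S := series (exp_coeff x).
have -> : \sum_(0 <= k < m) x ^+ k / k`!%:R = S m by [].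
have cS : S n @[n --> \oo] --> expR x by exact: is_cvg_series_exp_coeff.
have cS' : `|S n - S m| @[n --> \oo] --> `|expR x - S m|.
  by apply: cvg_norm; apply: cvgB => //; exact: cvg_cst.
rewrite -(cvg_lim _ cS')//; apply: limr_le.
  by apply/cvg_ex; eexists; exact: cS'.
near=> n.
have mn : (m <= n)%N by near: n; exact: nbhs_infty_ge.
rewrite /S /series/= (big_cat_nat (leq0n m) mn)/= addrAC subrr add0r.
apply: le_trans (ler_norm_sum _ _ _) _.
rewrite -{1}(add0n m) big_addn.
apply: (@le_trans _ _ (\sum_(0 <= i < n - m) `|x| ^+ m * (`|x| ^+ i / i`!%:R))).
  apply: ler_sum => i _; rewrite /exp_coeff/= normrM normrX normfV normr_nat.
  rewrite exprD (mulrC (_ ^+ i)) -mulrA ler_wpM2l ?exprn_ge0//.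
  rewrite ler_wpM2l ?exprn_ge0// lef_pV2 ?posrE ?ltr0n ?fact_gt0//.
  rewrite ler_nat (fact_split (leq_addr m i)) leq_pmulr//.
  by rewrite big_add1 prodn_gt0.
rewrite -mulr_sumr ler_wpM2l ?exprn_ge0//.
exact: series_exp_coeff_le.
Unshelve. all: by end_near. Qed.

(** Both bounds come from [ln (1 + z) <= z], taken at [z = y] and at
    [z = - y / (1 + y)], where [1 + z = (1 + y)^-1]. *)
Lemma ln1D_bound y : `|y| <= 2^-1 -> `|ln (1 + y) - y| <= 2 * y ^+ 2.
Proof.
move=> hy; have /andP[y1 y2] : - 2^-1 <= y <= 2^-1 by rewrite -ler_norml.
have y10 : 0 < 1 + y by lra.
have u : ln (1 + y) <= y by apply: le_ln1Dx; lra.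
have l : y - y ^+ 2 / (1 + y) <= ln (1 + y).
  have -> : ln (1 + y) = - ln (1 + (- (y / (1 + y)))).
    rewrite (_ : 1 + - (y / (1 + y)) = (1 + y)^-1); last by field; lra.
    by rewrite lnV ?opprK.
  rewrite lerNr; apply: le_trans (le_ln1Dx _) _.
    rewrite ltrN2 ltr_pdivrMr//; lra.
  have -> : y - y ^+ 2 / (1 + y) = y / (1 + y) by field; lra.
  lra.
have q : y ^+ 2 / (1 + y) <= 2 * y ^+ 2.
  rewrite ler_pdivrMr//; nra.
rewrite ler_norml; apply/andP; split; nra.
Qed.

End real_bounds.

(** * The dot product and coercive quadratic forms *)

Section dot_product.
Context {R : realType} {p : nat}.
Implicit Types (u v w : 'cV[R]_p) (M : 'M[R]_p).

Definition dot u v : R := (u^T *m v) 0 0.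

Lemma dotE u v : dot u v = \sum_i u i 0 * v i 0.
Proof. by rewrite /dot mxE; apply: eq_bigr => i _; rewrite mxE. Qed.

Lemma dotC u v : dot u v = dot v u.
Proof. by rewrite !dotE; apply: eq_bigr => i _; rewrite mulrC. Qed.

Lemma dotDl u v w : dot (u + v) w = dot u w + dot v w.
Proof. by rewrite /dot linearD/= mulmxDl mxE. Qed.

Lemma dotDr u v w : dot w (u + v) = dot w u + dot w v.
Proof. by rewrite dotC dotDl !(dotC w). Qed.

Lemma dotZl k u v : dot (k *: u) v = k * dot u v.
Proof. by rewrite /dot linearZ/= -scalemxAl mxE. Qed.

Lemma dotZr k u v : dot v (k *: u) = k * dot v u.
Proof. by rewrite dotC dotZl dotC. Qed.

Lemma dotNl u v : dot (- u) v = - dot u v.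
Proof. by rewrite -scaleN1r dotZl mulN1r. Qed.

Lemma dotNr u v : dot v (- u) = - dot v u.
Proof. by rewrite dotC dotNl dotC. Qed.

Lemma dotBr u v w : dot w (u - v) = dot w u - dot w v.
Proof. by rewrite dotDr dotNr. Qed.

Lemma dot_sumr u (n : nat) (F : 'I_n -> 'cV[R]_p) :
  dot u (\sum_i F i) = \sum_i dot u (F i).
Proof. by rewrite /dot mulmx_sumr summxE. Qed.

Lemma dot_delta i u : dot (delta_mx i 0) u = u i 0.
Proof.
rewrite dotE (bigD1 i)//= mxE !eqxx mul1r big1 ?addr0// => j ji.
by rewrite mxE (negbTE ji) mul0r.
Qed.

Lemma dot_sym M u v : M^T = M -> dot u (M *m v) = dot v (M *m u).
Proof.
move=> sM; rewrite /dot -[LHS]trace_mx11 -mxtrace_tr !trmx_mul trmxK sM.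
by rewrite trace_mx11 mulmxA.
Qed.

Lemma coord_le_norm u i : `|u i 0| <= `|u|.
Proof.
have -> : `|u| = mx_norm u by [].
by rewrite mx_normrE; exact: (le_bigmax _ (fun ij => `|u ij.1 ij.2|) (i, 0)).
Qed.

Lemma norm_le_coord u (c : R) :
  0 <= c -> (forall i, `|u i 0| <= c) -> `|u| <= c.
Proof.
move=> c0 uc; have -> : `|u| = mx_norm u by [].
rewrite mx_normrE; apply/bigmax_leP; split=> //.
by move=> [i j] _; rewrite ord1.
Qed.

Lemma dot_le u v : `|dot u v| <= p%:R * (`|u| * `|v|).
Proof.
rewrite dotE; apply: le_trans (ler_norm_sum _ _ _) _.
apply: le_trans (ler_sum _ (G := fun=> `|u| * `|v|) _) _.
  by move=> i _; rewrite normrM ler_pM// coord_le_norm.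
by rewrite sumr_const card_ord mulr_natl.
Qed.

Lemma mulmx_norm_bound M :
  exists2 c : R, 0 <= c & forall u, `|M *m u| <= c * `|u|.
Proof.
exists (\sum_i \sum_j `|M i j|) => [|u].
  by apply: sumr_ge0 => i _; apply: sumr_ge0.
apply: norm_le_coord => [|i].
  by rewrite mulr_ge0//; apply: sumr_ge0 => i _; apply: sumr_ge0.
rewrite mxE; apply: le_trans (ler_norm_sum _ _ _) _.
apply: (@le_trans _ _ (\sum_j `|M i j| * `|u|)).
  by apply: ler_sum => j _; rewrite normrM ler_wpM2l// coord_le_norm.
rewrite -mulr_suml ler_wpM2r// [leRHS](bigD1 i)//= lerDl.
by apply: sumr_ge0 => k _; apply: sumr_ge0.
Qed.

Definition psd M := forall u, 0 <= dot u (M *m u).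

(** Cauchy-Schwarz for the semidefinite form, applied to [u] and a basis vector,
    bounds the squared coordinates of [M *m u] by a multiple of
    [dot u (M *m u)]; and [`|u|] is controlled by [`|M *m u|], because [M] is
    invertible. *)
Lemma psd_unitmx_coercive M : M^T = M -> psd M -> M \in unitmx ->
  exists2 lam : R, 0 < lam & forall u, lam * `|u| ^+ 2 <= dot u (M *m u).
Proof.
move=> sM pM uM.
have [c c0 hc] := mulmx_norm_bound (invmx M).
pose C : R := 1 + \sum_i `|M i i|.
have C1 : 1 <= C by rewrite lerDl; apply: sumr_ge0.
have C0 : 0 < C by lra.
have key u i : ((M *m u) i 0) ^+ 2 <= C * dot u (M *m u).
  set b := (M *m u) i 0; set a := dot u _.
  (* the minimiser of [a + 2 t b + t ^+ 2 C], a majorant of the form at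
     [u + t *: delta_mx i 0] *)
  pose t : R := - b / C.
  have := pM (u + t *: delta_mx i 0).
  rewrite mulmxDr -scalemxAr !(dotDl, dotDr, dotZl, dotZr).
  rewrite (dot_sym u (delta_mx i 0) sM) !dot_delta -/a -/b.
  have -> : (M *m (delta_mx i 0 : 'cV[R]_p)) i 0 = M i i.
    by rewrite -colE mxE.
  have Mii : M i i <= C.
    apply: le_trans (ler_norm _) _; rewrite /C (bigD1 i)//= addrCA lerDl.
    by rewrite addr_ge0// sumr_ge0.
  rewrite -/b => h; have : 0 <= a + 2 * t * b + t ^+ 2 * C.
    apply: le_trans h _; move: Mii (sqr_ge0 t); clear; nra.
  have -> : a + 2 * t * b + t ^+ 2 * C = a - b ^+ 2 / C.
    by rewrite /t; field; rewrite gt_eqF.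
  by rewrite subr_ge0 ler_pdivrMr// mulrC.
clear sM.
exists ((C * (c + 1) ^+ 2)^-1) => [|u].
  by rewrite invr_gt0 mulr_gt0// exprn_gt0// ltr_wpDl.
have a0 := pM u.
have Mu : `|M *m u| ^+ 2 <= C * dot u (M *m u).
  rewrite -[leRHS]sqr_sqrtr; last by rewrite mulr_ge0// ltW.
  rewrite lerXn2r ?nnegrE ?sqrtr_ge0//; apply: norm_le_coord => [|i].
    exact: sqrtr_ge0.
  rewrite -sqrtr_sqr; apply: ler_wsqrtr; exact: key.
have uu : `|u| <= (c + 1) * `|M *m u|.
  have := hc (M *m u); rewrite mulKmx// => /le_trans; apply.
  by rewrite ler_wpM2r//; lra.
rewrite mulrC ler_pdivrMr; last by rewrite mulr_gt0// exprn_gt0// ltr_wpDl.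
apply: (@le_trans _ _ (((c + 1) * `|M *m u|) ^+ 2)).
  by rewrite lerXn2r ?nnegrE// mulr_ge0//; lra.
rewrite exprMn [leRHS]mulrA [leRHS]mulrC (mulrC _ C).
by rewrite ler_wpM2l// exprn_ge0//; lra.
Qed.

End dot_product.

(** * Measurability of vector-valued functions *)

Section measurable_coords.
Context {d} {S : measurableType d} {R : realType} {p : nat}.
Implicit Types (Y Z : S -> 'cV[R]_p).

Definition measurable_coords Y :=
  forall i, measurable_fun [set: S] (fun x => Y x i 0).

Lemma measurable_vnorm Y :
  measurable_coords Y -> measurable_fun [set: S] (fun x => `|Y x|).
Proof.
move=> mY.
have -> : (fun x => `|Y x|) =
    (fun x => \big[Num.max/0]_ij `|Y x ij.1 ij.2|).
  by apply/funext => x; rewrite -mx_normrE.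
elim: (index_enum _) => [|[i j] s ih].
  by under eq_fun do rewrite big_nil; exact: measurable_cst.
under eq_fun do rewrite big_cons.
apply: measurable_maxr => //=; apply: measurableT_comp => //.
by rewrite ord1.
Qed.

Lemma measurable_dot Y v :
  measurable_coords Y -> measurable_fun [set: S] (fun x => dot v (Y x)).
Proof.
move=> mY.
under eq_fun do rewrite dotE.
by apply: measurable_sum => i; exact: measurable_funM.
Qed.

Lemma measurable_coords_cst u : measurable_coords (fun=> u).
Proof. by move=> i; exact: measurable_cst. Qed.

Lemma measurable_coordsZ k Y :
  measurable_coords Y -> measurable_coords (fun x => k *: Y x).
Proof. by move=> mY i; under eq_fun do rewrite mxE; exact: measurable_funM. Qed.

Lemma measurable_coordsB Y Z : measurable_coords Y -> measurable_coords Z ->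
  measurable_coords (fun x => Y x - Z x).
Proof.
move=> mY mZ i; under eq_fun do rewrite mxE [X in _ + X]mxE.
exact: measurable_funB.
Qed.

Lemma measurable_coords_sum n (Y : 'I_n -> S -> 'cV[R]_p) :
  (forall k, measurable_coords (Y k)) ->
  measurable_coords (fun x => \sum_k Y k x).
Proof.
move=> mY i; under eq_fun do rewrite summxE.
by apply: measurable_sum => k; exact: mY.
Qed.

Lemma measurable_coords_mulmx (M : 'M[R]_p) Y :
  measurable_coords Y -> measurable_coords (fun x => M *m Y x).
Proof.
move=> mY i; under eq_fun do rewrite mxE.
by apply: measurable_sum => k; exact: measurable_funM.
Qed.

Lemma measurable_norm_gt Y (c : R) : measurable_coords Y ->
  measurable [set x | c < `|Y x|].
Proof.
move=> mY; rewrite -[X in measurable X]setTI.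
have -> : [set x | c < `|Y x|] = (fun x => `|Y x|) @^-1` `]c, +oo[.
  by apply/seteqP; split=> x /=; rewrite in_itv/= andbT.
exact: measurable_vnorm.
Qed.

End measurable_coords.

(** * Finite sums under the integral *)

Section finite_sums.
Context {d} {S : measurableType d} {R : realType}.
Variables (mu : {measure set S -> \bar R}) (I : Type) (F : I -> S -> R).
Hypothesis Fi : forall i, mu.-integrable setT (EFin \o F i).

Lemma integrable_Rsum (s : seq I) :
  mu.-integrable setT (EFin \o (fun x => \sum_(i <- s) F i x)).
Proof.
have hs := @integrable_sum _ _ _ mu _ measurableT _ s xpredT
  (fun i => EFin \o F i) (fun i _ => Fi i).
by apply: eq_integrable hs => // x _; rewrite /= sumEFin.
Qed.

Lemma Rintegral_sum (s : seq I) :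
  \int[mu]_x (\sum_(i <- s) F i x) = \sum_(i <- s) \int[mu]_x F i x.
Proof.
elim: s => [|i s ih].
  rewrite big_nil /Rintegral integral0_eq// => x _.
  by rewrite big_nil.
rewrite big_cons -ih -RintegralD//; last exact: integrable_Rsum.
by apply: eq_Rintegral => x _; rewrite big_cons.
Qed.

End finite_sums.

(** * Expectations under a density *)

Section weighted_integral.
Context {d} {S : measurableType d} {R : realType}.
Variables (nu : {measure set S -> \bar R}) (w : S -> R).
Hypotheses (mw : measurable_fun [set: S] w) (w0 : forall x, 0 <= w x).
Implicit Types f g : S -> R.

(** Integrability and expectation under the law of density [w], expressed
    through the common dominating measure [nu]: two laws of an exponential
    family are then compared by moving factors between the weight and the
    integrand. *)
Definition wint f := nu.-integrable setT (fun x => (f x * w x)%:E).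
Definition wexp f : R := \int[nu]_x (f x * w x).

Lemma wintD f g : wint f -> wint g -> wint (fun x => f x + g x).
Proof.
move=> fi gi; apply: eq_integrable (integrableD _ fi gi) => // x _.
by rewrite /= mulrDl EFinD.
Qed.

Lemma wintZ k f : wint f -> wint (fun x => k * f x).
Proof.
move=> fi; apply: eq_integrable (integrableZl _ k fi) => // x _.
by rewrite /= -EFinM mulrA.
Qed.

Lemma wintB f g : wint f -> wint g -> wint (fun x => f x - g x).
Proof.
move=> fi gi; apply: eq_integrable (integrableB _ fi gi) => // x _.
by rewrite /= mulrBl EFinB.
Qed.

Lemma wint_sum (I : Type) (s : seq I) (F : I -> S -> R) :
  (forall i, wint (F i)) -> wint (fun x => \sum_(i <- s) F i x).
Proof.
move=> Fi; rewrite /wint; under eq_fun do rewrite mulr_suml.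
exact: (integrable_Rsum Fi).
Qed.

Lemma wexpD f g : wint f -> wint g ->
  wexp (fun x => f x + g x) = wexp f + wexp g.
Proof.
move=> fi gi; rewrite /wexp -RintegralD//.
by apply: eq_Rintegral => x _; rewrite mulrDl.
Qed.

Lemma wexpZ k f : wint f -> wexp (fun x => k * f x) = k * wexp f.
Proof.
move=> fi; rewrite /wexp -RintegralZl//.
by apply: eq_Rintegral => x _; rewrite mulrA.
Qed.

Lemma wexpB f g : wint f -> wint g ->
  wexp (fun x => f x - g x) = wexp f - wexp g.
Proof.
move=> fi gi; rewrite /wexp -RintegralB//.
by apply: eq_Rintegral => x _; rewrite mulrBl.
Qed.

Lemma wexp_sum (I : Type) (s : seq I) (F : I -> S -> R) :
  (forall i, wint (F i)) ->
  wexp (fun x => \sum_(i <- s) F i x) = \sum_(i <- s) wexp (F i).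
Proof.
move=> Fi; rewrite /wexp; under eq_Rintegral do rewrite mulr_suml.
exact: (Rintegral_sum Fi).
Qed.

Lemma wexp_ge0 f : (forall x, 0 <= f x) -> 0 <= wexp f.
Proof. by move=> f0; apply: Rintegral_ge0 => x _; rewrite mulr_ge0. Qed.

Lemma wint_dominated f g : measurable_fun setT f ->
  (forall x, `|f x| <= g x) -> wint g -> wint f.
Proof.
move=> mf fg; apply: le_integrable => //.
  by apply/measurable_EFinP; exact: measurable_funM.
move=> x _; rewrite lee_fin !normrM ler_wpM2r//.
by apply: le_trans (fg x) _; exact: ler_norm.
Qed.

Lemma wexp_le f g : measurable_fun setT f ->
  (forall x, `|f x| <= g x) -> wint g -> `|wexp f| <= wexp g.
Proof.
move=> mf fg gi; have fi := wint_dominated mf fg gi.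
apply: le_trans (le_normr_Rintegral measurableT fi) _.
apply: le_Rintegral => //; first exact: integrable_norm.
by move=> x _; rewrite /= normrM (ger0_norm (w0 x)) ler_wpM2r.
Qed.

End weighted_integral.

(** * Expansions of the moment generating function *)

Section moment_generating_function.
Context {d} {S : measurableType d} {R : realType} {p : nat}.
Variables (nu : {measure set S -> \bar R}) (w : S -> R) (Y : S -> 'cV[R]_p).
Hypotheses (mw : measurable_fun [set: S] w) (w0 : forall x, 0 <= w x).
Hypothesis mY : measurable_coords Y.
Variable b : R.
Implicit Type v : 'cV[R]_p.
Hypotheses (b0 : 0 < b) (bY : wint nu w (fun x => expR (b * `|Y x|))).

(** Half of the exponential moment pays for the polynomial factor. *)
Lemma expr_expR_le k (r t : R) : 0 <= t -> r <= b / 2 ->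
  t ^+ k * expR (r * t) <= k`!%:R * (2 / b) ^+ k * expR (b * t).
Proof.
move=> t0 rb.
apply: (@le_trans _ _ (t ^+ k * expR (b / 2 * t))).
  by rewrite ler_wpM2l ?exprn_ge0// ler_expR ler_wpM2r.
have -> : expR (b * t) = expR (b / 2 * t) * expR (b / 2 * t).
  by rewrite -expRD; congr expR; field.
rewrite mulrA ler_wpM2r ?expR_ge0//.
have h : 0 <= b / 2 * t by rewrite mulr_ge0// divr_ge0// ltW.
have := expr_le_expR k h; rewrite exprMn => hk.
rewrite -mulrA mulrCA -ler_pdivrMl ?exprn_gt0 ?divr_gt0//.
by rewrite -exprVn invf_div.
Qed.

Definition moment_bound k : R :=
  k`!%:R * (2 / b) ^+ k * wexp nu w (fun x => expR (b * `|Y x|)).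

Lemma moment_bound_ge0 k : 0 <= moment_bound k.
Proof.
rewrite /moment_bound mulr_ge0//; last first.
  by apply: wexp_ge0 => // x; exact: expR_ge0.
by rewrite mulr_ge0// exprn_ge0// divr_ge0// ltW.
Qed.

Lemma wint_poly_exp k (c r : R) (f : S -> R) :
  measurable_fun setT f -> 0 <= c -> r <= b / 2 ->
  (forall x, `|f x| <= c * (`|Y x| ^+ k * expR (r * `|Y x|))) -> wint nu w f.
Proof.
move=> mf c0 rb fb.
apply: (@wint_dominated _ _ _ _ _ mw _
  (fun x => (c * (k`!%:R * (2 / b) ^+ k)) * expR (b * `|Y x|))) => //.
  move=> x; apply: le_trans (fb x) _; rewrite -mulrA ler_wpM2l//.
  exact: expr_expR_le.
exact: wintZ.
Qed.

Lemma wexp_poly_exp k (c r : R) (f : S -> R) :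
  measurable_fun setT f -> 0 <= c -> r <= b / 2 ->
  (forall x, `|f x| <= c * (`|Y x| ^+ k * expR (r * `|Y x|))) ->
  `|wexp nu w f| <= c * moment_bound k.
Proof.
move=> mf c0 rb fb.
apply: (@le_trans _ _ (wexp nu w
  (fun x => (c * (k`!%:R * (2 / b) ^+ k)) * expR (b * `|Y x|)))).
  apply: wexp_le => //; last exact: wintZ.
  move=> x; apply: le_trans (fb x) _; rewrite -mulrA ler_wpM2l//.
  exact: expr_expR_le.
by rewrite wexpZ// -mulrA.
Qed.

Lemma wint_coord i : wint nu w (fun x => Y x i 0).
Proof.
apply: (@wint_poly_exp 1 1 0) => //; first by rewrite divr_ge0// ltW.
by move=> x; rewrite mul1r mul0r expR0 mulr1 expr1 coord_le_norm.
Qed.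

Lemma wint_coord2 i j : wint nu w (fun x => Y x i 0 * Y x j 0).
Proof.
apply: (@wint_poly_exp 2 1 0) => //; first exact: measurable_funM.
  by rewrite divr_ge0// ltW.
move=> x; rewrite mul1r mul0r expR0 mulr1 normrM expr2.
by rewrite ler_pM// coord_le_norm.
Qed.

Lemma wint_one : wint nu w (cst 1).
Proof.
apply: (@wint_poly_exp 0 1 0) => //; first by rewrite divr_ge0// ltW.
by move=> x; rewrite mul1r mul0r expR0 mulr1 expr0 normr1.
Qed.

Hypothesis w1 : wexp nu w (cst 1) = 1.
Hypothesis centred : forall i, wexp nu w (fun x => Y x i 0) = 0.

Definition second_moment : 'M[R]_p :=
  \matrix_(i, j) wexp nu w (fun x => Y x i 0 * Y x j 0).

Lemma second_moment_sym : second_moment^T = second_moment.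
Proof.
apply/matrixP => i j; rewrite !mxE.
by congr wexp; apply/funext => x; rewrite mulrC.
Qed.

Lemma wint_dot v : wint nu w (fun x => dot v (Y x)).
Proof.
under eq_fun do rewrite dotE.
by apply: wint_sum => i; apply: wintZ; exact: wint_coord.
Qed.

Lemma wexp_dot v : wexp nu w (fun x => dot v (Y x)) = 0.
Proof.
under eq_fun do rewrite dotE.
rewrite wexp_sum => [|i]; last by apply: wintZ; exact: wint_coord.
by rewrite big1// => i _; rewrite wexpZ ?centred ?mulr0//; exact: wint_coord.
Qed.

Lemma wint_coord_dot i v : wint nu w (fun x => Y x i 0 * dot v (Y x)).
Proof.
under eq_fun do rewrite dotE mulr_sumr.
apply: wint_sum => j.
by under eq_fun do rewrite mulrCA; apply: wintZ; exact: wint_coord2.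
Qed.

Lemma wexp_coord_dot i v :
  wexp nu w (fun x => Y x i 0 * dot v (Y x)) = (second_moment *m v) i 0.
Proof.
under eq_fun do rewrite dotE mulr_sumr.
rewrite wexp_sum => [|j]; last first.
  by under eq_fun do rewrite mulrCA; apply: wintZ; exact: wint_coord2.
rewrite mxE; apply: eq_bigr => j _; rewrite mxE mulrC.
rewrite -wexpZ; last exact: wint_coord2.
by congr wexp; apply/funext => x; rewrite mulrCA.
Qed.

Lemma wint_dot2 v : wint nu w (fun x => dot v (Y x) ^+ 2).
Proof.
under eq_fun do rewrite expr2 {1}dotE mulr_suml.
apply: wint_sum => j.
by under eq_fun do rewrite -mulrA; apply: wintZ; exact: wint_coord_dot.
Qed.

Lemma wexp_dot2 v :
  wexp nu w (fun x => dot v (Y x) ^+ 2) = dot v (second_moment *m v).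
Proof.
under eq_fun do rewrite expr2 {1}dotE mulr_suml.
rewrite wexp_sum => [|j]; last first.
  by under eq_fun do rewrite -mulrA; apply: wintZ; exact: wint_coord_dot.
rewrite dotE; apply: eq_bigr => j _; rewrite -wexp_coord_dot.
rewrite -wexpZ; last exact: wint_coord_dot.
by congr wexp; apply/funext => x; rewrite mulrA.
Qed.

Lemma second_moment_psd : psd second_moment.
Proof.
by move=> u; rewrite -wexp_dot2; apply: wexp_ge0 => // x; exact: sqr_ge0.
Qed.

(* for [`|v| <= delta], [`|dot v y| <= b / 2 * `|y|] *)
Let delta : R := b / 2 / (p%:R + 1).

Let dot_small (v y : 'cV[R]_p) : `|v| <= delta ->
  `|dot v y| <= p%:R * `|v| * `|y| /\ p%:R * `|v| <= b / 2.
Proof.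
move=> vd; split; first by rewrite -mulrA; exact: dot_le.
apply: (@le_trans _ _ ((p%:R + 1) * `|v|)); first by rewrite ler_wpM2r// lerDl.
by rewrite mulrC -ler_pdivlMr.
Qed.

Let exp_remainder (v : 'cV[R]_p) x m : `|v| <= delta ->
  `|dot v (Y x)| ^+ m * expR `|dot v (Y x)| <=
  (p%:R * `|v|) ^+ m * (`|Y x| ^+ m * expR (p%:R * `|v| * `|Y x|)).
Proof.
move=> vd; have [h1 h2] := dot_small (Y x) vd.
rewrite mulrA -exprMn ler_pM ?exprn_ge0 ?expR_ge0 ?ler_expR//.
by rewrite lerXn2r ?nnegrE ?mulr_ge0.
Qed.

Let delta_gt0 : 0 < delta.
Proof. by rewrite /delta !divr_gt0//; apply: ltr_pwDr => //; rewrite ler0n. Qed.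

Lemma wint_expR_dot v : `|v| <= delta ->
  wint nu w (fun x => expR (dot v (Y x))).
Proof.
move=> vd; apply: (@wint_poly_exp 0 1 (p%:R * `|v|)) => //.
- by apply: measurableT_comp => //; exact: measurable_dot.
- by have [] := dot_small 0 vd.
move=> x; have := exp_remainder x 0 vd; rewrite !expr0 !mul1r.
by apply: le_trans; rewrite ger0_norm ?expR_ge0// ler_expR ler_norm.
Qed.

Lemma wint_coord_expR_dot i v : `|v| <= delta ->
  wint nu w (fun x => Y x i 0 * expR (dot v (Y x))).
Proof.
move=> vd; apply: (@wint_poly_exp 1 1 (p%:R * `|v|)) => //.
- apply: measurable_funM => //.
  by apply: measurableT_comp => //; exact: measurable_dot.
- by have [] := dot_small 0 vd.
move=> x; have := exp_remainder x 0 vd; rewrite !expr0 !mul1r => h.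
rewrite normrM expr1 ler_pM// ?coord_le_norm//.
by apply: le_trans h; rewrite ger0_norm ?expR_ge0// ler_expR ler_norm.
Qed.

(** The remainder of order three is integrated directly: pointwise it is at most
    [`|dot v Y| ^+ 3 * expR `|dot v Y|], and an exponential moment of [`|Y|]
    dominates this with a factor [`|v| ^+ 3]. *)
Lemma mgf_expansion : exists C delta : R, [/\ 0 <= C, 0 < delta &
  forall v, `|v| <= delta ->
  `|wexp nu w (fun x => expR (dot v (Y x))) - 1
    - 2^-1 * dot v (second_moment *m v)| <= C * `|v| ^+ 3].
Proof.
exists (p%:R ^+ 3 * moment_bound 3), delta; split=> // [|v vd].
  by rewrite mulr_ge0 ?exprn_ge0// moment_bound_ge0.
have -> : wexp nu w (fun x => expR (dot v (Y x))) - 1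
    - 2^-1 * dot v (second_moment *m v) =
  wexp nu w (fun x => expR (dot v (Y x)) - (1 + dot v (Y x) +
    2^-1 * dot v (Y x) ^+ 2)).
  have i2 : wint nu w (fun x => 2^-1 * dot v (Y x) ^+ 2).
    by apply: wintZ; exact: wint_dot2.
  have i1 : wint nu w (fun x => 1 + dot v (Y x)).
    by apply: wintD; [exact: wint_one|exact: wint_dot].
  rewrite wexpB//; [|exact: wint_expR_dot|exact: wintD].
  rewrite wexpD// wexpD//; [|exact: wint_one|exact: wint_dot].
  rewrite wexpZ; last exact: wint_dot2.
  by rewrite wexp_dot2 wexp_dot w1 addr0 opprD addrA.
rewrite mulrAC -exprMn; apply: (@wexp_poly_exp 3 _ (p%:R * `|v|)).
- have md := measurable_dot v mY.
  apply: measurable_funB; first by apply: measurableT_comp.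
  apply: measurable_funD; first exact: measurable_funD.
  by apply: measurable_funM => //; apply: measurable_funX.
- by rewrite exprn_ge0// mulr_ge0.
- by have [] := dot_small 0 vd.
move=> x; apply: le_trans (exp_remainder x 3 vd).
apply: le_trans (expR_taylor_bound 3 _).
rewrite !big_nat_recr ?big_geq//= !(fact0, factS, muln1).
rewrite !expr0 expr1 add0r !divr1.
by rewrite (mulrC 2^-1).
Qed.

(** Up to normalisation, this is the mean of [Y] under the law tilted by
    [expR (dot v Y)]; its linear part is what makes the second moment the
    derivative of the mean. *)
Lemma tilted_mean_expansion : exists C delta : R, [/\ 0 <= C, 0 < delta &
  forall v i, `|v| <= delta ->
  `|wexp nu w (fun x => Y x i 0 * expR (dot v (Y x)))
    - (second_moment *m v) i 0| <= C * `|v| ^+ 2].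
Proof.
exists (p%:R ^+ 2 * moment_bound 3), delta; split=> // [|v i vd].
  by rewrite mulr_ge0 ?exprn_ge0// moment_bound_ge0.
have -> : wexp nu w (fun x => Y x i 0 * expR (dot v (Y x)))
    - (second_moment *m v) i 0 =
  wexp nu w (fun x => Y x i 0 * expR (dot v (Y x)) - (Y x i 0 +
    Y x i 0 * dot v (Y x))).
  have i2 := wint_coord_dot i v; have i1 := wint_coord i.
  rewrite wexpB//; [|exact: wint_coord_expR_dot|exact: wintD].
  by rewrite wexpD// centred add0r wexp_coord_dot.
rewrite mulrAC -exprMn; apply: (@wexp_poly_exp 3 _ (p%:R * `|v|)).
- have md := measurable_dot v mY.
  apply: measurable_funB.
    by apply: measurable_funM => //; apply: measurableT_comp.
  by apply: measurable_funD => //; exact: measurable_funM.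
- by rewrite exprn_ge0// mulr_ge0.
- by have [] := dot_small 0 vd.
move=> x.
have -> : Y x i 0 * expR (dot v (Y x)) - (Y x i 0 + Y x i 0 * dot v (Y x)) =
    Y x i 0 * (expR (dot v (Y x)) - (1 + dot v (Y x))) by ring.
rewrite exprS -(mulrA `|Y x|) [leRHS]mulrCA normrM ler_pM ?coord_le_norm//.
apply: le_trans (exp_remainder x 2 vd).
apply: le_trans (expR_taylor_bound 2 _).
rewrite !big_nat_recr ?big_geq//= !(fact0, factS, muln1).
by rewrite !expr0 expr1 add0r !divr1.
Qed.

End moment_generating_function.

(** * Partial derivatives and Borel measurability *)

Section taylor_partial.
Context {R : realType} {p : nat}.
Implicit Types (f : 'cV[R]_p -> R) (u v m : 'cV[R]_p) (H : set 'cV[R]_p).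

Lemma open_closed_ball H u : open H -> H u ->
  exists2 e : R, 0 < e & forall v, `|v| <= e -> H (u + v).
Proof.
move=> oH Hu; have /nbhs_ballP[e /= e0 eH] := open_nbhs_nbhs (conj oH Hu).
exists (e / 2) => [|v ve]; first by rewrite divr_gt0.
apply: eH; rewrite mx_norm_ball /ball_/= opprD addrA subrr sub0r normrN.
by apply: le_lt_trans ve _; rewrite ltr_pdivrMr// ltr_pMr// ltr1n.
Qed.

Lemma partial_taylor f u m (C delta : R) : 0 < delta ->
  (forall v, `|v| <= delta -> `|f (u + v) - f u - dot v m| <= C * `|v| ^+ 2) ->
  forall i, partial i f u = m i 0.
Proof.
move=> d0 fC i; apply/cvg_lim => //; apply/cvgrPdist_le => e e0.
have nd : `|delta_mx i 0 : 'cV[R]_p| <= 1.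
  apply: norm_le_coord => // j; rewrite mxE.
  by case: (_ && _); rewrite ?normr1 ?normr0.
have C0 : 0 < `|C| + 1 by rewrite ltr_wpDl.
near=> t.
have t0 : t != 0 by near: t; exact: nbhs_dnbhs_neq.
have td : `|t *: delta_mx i 0 : 'cV[R]_p| <= `|t|.
  by rewrite normrZ ler_piMr.
have te : `|t| <= e / (`|C| + 1) by near: t; apply: dnbhs0_le; rewrite divr_gt0.
have := fC (t *: delta_mx i 0) _.
rewrite dotZl dot_delta /= => /(_ _)/wrap[].
  by apply: le_trans td _; near: t; exact: dnbhs0_le.
move=> h; rewrite /shift/= (addrC _ u).
set D := f _ - f u in h *.
have -> : m i 0 - t^-1 *: D = - (t^-1 * (D - t * m i 0)).
  by rewrite mulrBr mulKf// opprB.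
rewrite normrN normrM normfV ler_pdivrMl ?normr_gt0//.
apply: le_trans h _; apply: (@le_trans _ _ ((`|C| + 1) * `|t| ^+ 2)).
  apply: (@le_trans _ _ ((`|C| + 1) * `|t *: delta_mx i 0 : 'cV[R]_p| ^+ 2)).
    by rewrite ler_wpM2r ?exprn_ge0// ler_wpDr// ler_norm.
  by rewrite ler_wpM2l ?(ltW C0)// lerXn2r// nnegrE.
by rewrite expr2 mulrCA ler_wpM2l// mulrC -ler_pdivlMr.
Unshelve. all: by end_near. Qed.

End taylor_partial.

Section borel.
Context {R : realType}.

Lemma continuous_borel_measurable (V : ptopologicalType) (f : V -> R) :
  continuous f -> measurable_fun [set: borelType V] (f : borelType V -> R).
Proof.
move=> /continuousP cf; apply: (measurability _ (RGenOpens.measurableE R)).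
move=> _ [_ [a [b ->] <-]]; rewrite setTI; apply: sub_sigma_algebra.
exact/cf/interval_open.
Qed.

Lemma borel_measurable_coords {d} {S : measurableType d} {p : nat}
    (f : S -> 'cV[R]_p) :
  measurable_fun [set: S] (f : S -> borelType 'cV[R]_p) -> measurable_coords f.
Proof.
move=> mf i; apply: (@measurableT_comp _ _ _ _ _ _
  ((fun u : 'cV[R]_p => u i 0) : borelType 'cV[R]_p -> R)) => //.
by apply: (@continuous_borel_measurable 'cV[R]_p); exact: coord_continuous.
Qed.

End borel.

(** * Exponential families *)

Section exponential_family.
Context {R : realType} {Omega : pmetricType R} {p : nat}.
Variables (nu : {measure set (borelType Omega) -> \bar R}) (H : set 'cV[R]_p)
  (h : Omega -> R) (T : Omega -> 'cV[R]_p) (A : 'cV[R]_p -> R).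
Hypothesis fam : exp_family nu H h T A.
Implicit Types (eta v : 'cV[R]_p) (f : borelType Omega -> R).

Notation dens := (exp_density h T A).
Notation intE eta := (wint nu (dens eta)).
Notation expE eta := (wexp nu (dens eta)).

Lemma statistic_coord_measurable :
  measurable_coords (T : borelType Omega -> 'cV[R]_p).
Proof. by apply: borel_measurable_coords; exact: ef_T_meas fam. Qed.

Lemma density_measurable eta :
  measurable_fun [set: borelType Omega] (dens eta : borelType Omega -> R).
Proof.
apply: measurable_funM; first exact: ef_h_meas fam.
apply: measurableT_comp => //; apply: measurable_funB => //.
exact: measurable_dot eta statistic_coord_measurable.
Qed.

Lemma density_ge0 eta x : 0 <= dens eta x.
Proof. by rewrite mulr_ge0 ?expR_ge0//; exact: ef_h_ge0 fam x. Qed.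

(** Moving the parameter by [v] multiplies the density by [expR (dot v (T x))],
    up to normalisation: the reason why the moment generating function of [T]
    at [v] is [expR (A (eta + v) - A eta)]. *)
Lemma density_shift eta v x : expR (dot v (T x)) * dens eta x =
  expR (A (eta + v) - A eta) * dens (eta + v) x.
Proof.
rewrite /exp_density -/(dot eta (T x)) -/(dot (eta + v) (T x)) dotDl.
rewrite mulrCA [RHS]mulrCA -!expRD; congr (_ * expR _); ring.
Qed.

Lemma density_integrable eta : H eta -> intE eta (cst 1).
Proof.
move=> He; apply/integrableP; split.
  apply/measurable_EFinP; apply: measurable_funM => //.
  exact: density_measurable.
rewrite (_ : (\int[nu]_x _)%E = 1%E) ?ltry//.
rewrite -(ef_normalized fam He); apply: eq_integral => x _.
by rewrite /= mul1r ger0_norm// density_ge0.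
Qed.

Lemma density_total eta : H eta -> expE eta (cst 1) = 1.
Proof.
move=> He; rewrite /wexp /Rintegral.
under eq_integral do rewrite mul1r.
by rewrite (ef_normalized fam He).
Qed.

Lemma integrable_shift eta v f : intE (eta + v) f ->
  intE eta (fun x => f x * expR (dot v (T x))).
Proof.
move=> fi; pose k := expR (A (eta + v) - A eta).
apply: eq_integrable (integrableZl _ k fi) => //.
by move=> x _; rewrite /= -EFinM -mulrA density_shift mulrCA.
Qed.

Lemma expectation_shift eta v f : intE (eta + v) f ->
  expE eta (fun x => f x * expR (dot v (T x))) =
  expR (A (eta + v) - A eta) * expE (eta + v) f.
Proof.
move=> fi; rewrite /wexp -RintegralZl//; apply: eq_Rintegral => x _.
by rewrite -mulrA density_shift mulrCA.
Qed.

Lemma expR_norm_le (b : R) (y : 'cV[R]_p) : 0 <= b ->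
  expR (b * `|y|) <= 1 + \sum_i (expR (b * y i 0) + expR (- b * y i 0)).
Proof.
move=> b0; have s0 (P : pred 'I_p) :
    0 <= \sum_(i | P i) (expR (b * y i 0) + expR (- b * y i 0)).
  by apply: sumr_ge0 => i _; rewrite addr_ge0 ?expR_ge0.
have [y0|/mx_norm_neq0[[i j] /= yi]] := eqVneq (mx_norm y) 0.
  rewrite (_ : `|y| = 0)// mulr0 expR0 lerDl; exact: s0.
rewrite (_ : `|y| = `|y i 0|); last by rewrite [LHS]yi ord1.
rewrite (bigD1 i)//= addrA ler_wpDr// ?s0//.
have [yi0|yi0] := ger0P (y i 0).
  by rewrite addrCA lerDl addr_ge0// expR_ge0.
by rewrite mulrN mulNr addrA lerDr addr_ge0// expR_ge0.
Qed.

(** Openness of the parameter set gives exponential moments in the directions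
    [+/- delta_mx i 0], and these dominate an exponential moment of the norm. *)
Lemma exp_norm_integrable eta : H eta ->
  exists2 b : R, 0 < b & intE eta (fun x => expR (b * `|T x|)).
Proof.
move=> He; have [b b0 Hb] := open_closed_ball (ef_open fam) He.
exists b => //.
have edge (c : R) i : `|c| <= b -> intE eta (fun x => expR (c * T x i 0)).
  move=> cb; have : H (eta + c *: delta_mx i 0).
    apply: Hb; apply: norm_le_coord => [|j]; first exact: ltW.
    rewrite !mxE; case: (_ && _); rewrite ?mulr1 ?mulr0 ?normr0//.
    exact: ltW.
  move=> /density_integrable/integrable_shift.
  by under eq_fun do rewrite dotZl dot_delta mul1r.
have bb : `|b| <= b by rewrite gtr0_norm.
have nbb : `| - b| <= b by rewrite normrN gtr0_norm.
apply: (@wint_dominated _ _ _ _ _ (density_measurable eta) _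
  (fun x => 1 + \sum_i (expR (b * T x i 0) + expR (- b * T x i 0)))) => [|x|].
- apply: measurableT_comp => //; apply: measurable_funM => //.
  exact: measurable_vnorm statistic_coord_measurable.
- by rewrite ger0_norm ?expR_ge0// expR_norm_le// ltW.
- apply: wintD; first exact: density_integrable.
  by apply: wint_sum => i; apply: wintD; exact: edge.
Qed.

Definition exp_mean eta : 'cV[R]_p := \col_i expE eta (fun x => T x i 0).

Definition centred_statistic eta (x : borelType Omega) : 'cV[R]_p :=
  T x - exp_mean eta.

Local Notation Y := centred_statistic.

Definition exp_cov eta : 'M[R]_p := second_moment nu (dens eta) (Y eta).

Lemma centred_measurable eta : measurable_coords (Y eta).
Proof.
apply: measurable_coordsB; last exact: measurable_coords_cst.
exact: statistic_coord_measurable.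
Qed.

Lemma statistic_coord_integrable eta i : H eta -> intE eta (fun x => T x i 0).
Proof.
move=> He; have [b b0 bT] := exp_norm_integrable He.
exact: (wint_coord (density_measurable eta) statistic_coord_measurable b0 bT).
Qed.

Lemma exp_norm_centred_integrable eta : H eta ->
  exists2 b : R, 0 < b & intE eta (fun x => expR (b * `|Y eta x|)).
Proof.
move=> He; have [b b0 bT] := exp_norm_integrable He; exists b => //.
apply: (@wint_dominated _ _ _ _ _ (density_measurable eta) _
  (fun x => expR (b * `|exp_mean eta|) * expR (b * `|T x|))) => [|x|].
- apply: measurableT_comp => //; apply: measurable_funM => //.
  exact: measurable_vnorm (centred_measurable eta).
- rewrite ger0_norm ?expR_ge0// -expRD ler_expR -mulrDr ler_wpM2l ?(ltW b0)//.
  by rewrite addrC ler_normB.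
- exact: wintZ.
Qed.

(** The centring at [eta'] may differ from the law at [eta]: this compares the
    means at two parameters. *)
Lemma expectation_centred eta eta' i : H eta ->
  intE eta (fun x => Y eta' x i 0) /\
  expE eta (fun x => Y eta' x i 0) = exp_mean eta i 0 - exp_mean eta' i 0.
Proof.
move=> He; have i1 := statistic_coord_integrable i He.
have i2 : intE eta (fun=> exp_mean eta' i 0 * 1).
  by apply: wintZ; exact: density_integrable.
have -> : (fun x => Y eta' x i 0) =
    (fun x => T x i 0 - exp_mean eta' i 0 * 1).
  by apply/funext => x; rewrite mulr1 2!mxE.
split; first exact: wintB.
rewrite wexpB// wexpZ; last exact: density_integrable.
by rewrite density_total// mulr1 [exp_mean eta i 0]mxE.
Qed.

Lemma centred_mean0 eta i : H eta -> expE eta (fun x => Y eta x i 0) = 0.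
Proof.
by move=> He; have [_ ->] := expectation_centred eta i He; rewrite subrr.
Qed.

Lemma expectation_centred_shift eta v f : intE (eta + v) f ->
  expE eta (fun x => f x * expR (dot v (Y eta x))) =
  expR (A (eta + v) - A eta - dot v (exp_mean eta)) * expE (eta + v) f.
Proof.
move=> fi; rewrite expRD mulrAC mulrC -expectation_shift// -wexpZ; last first.
  exact: integrable_shift.
congr (wexp _ _ _); apply/funext => x.
by rewrite dotBr expRD mulrA mulrC.
Qed.

Lemma exp_cov_norm_le eta : exists2 c : R, 0 <= c & forall v,
  `|exp_cov eta *m v| <= c * `|v| /\
  `|2^-1 * dot v (exp_cov eta *m v)| <= c * `|v| ^+ 2.
Proof.
have [c c0 hc] := mulmx_norm_bound (exp_cov eta).
have p0 : 0 <= p%:R :> R by [].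
exists (c * (p%:R + 1)) => [|v]; first by rewrite mulr_ge0// addr_ge0.
split; first by apply: le_trans (hc v) _; rewrite ler_wpM2r// ler_peMr// lerDr.
rewrite normrM ger0_norm//; apply: (@le_trans _ _ (p%:R * (`|v| * (c * `|v|)))).
  apply: (@le_trans _ _ (1 * `|dot v (exp_cov eta *m v)|)).
    by rewrite ler_wpM2r// invf_le1// ler1n.
  rewrite mul1r; apply: le_trans (dot_le _ _) _.
  by rewrite ler_wpM2l// ler_wpM2l.
rewrite (_ : p%:R * (`|v| * (c * `|v|)) = p%:R * (c * `|v| ^+ 2)); last by ring.
have -> : c * (p%:R + 1) * `|v| ^+ 2 = p%:R * (c * `|v| ^+ 2) + c * `|v| ^+ 2.
  by ring.
by rewrite lerDl mulr_ge0// exprn_ge0.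
Qed.

End exponential_family.

(** * Regularity and convexity of the log-normalizer *)

Section log_normalizer.
Context {R : realType} {Omega : pmetricType R} {p : nat}.
Variables (nu : {measure set (borelType Omega) -> \bar R}) (H : set 'cV[R]_p)
  (h : Omega -> R) (T : Omega -> 'cV[R]_p) (A : 'cV[R]_p -> R).
Hypothesis fam : exp_family nu H h T A.
Implicit Types (eta v : 'cV[R]_p) (f : borelType Omega -> R).

Notation dens := (exp_density h T A).
Notation intE eta := (wint nu (dens eta)).
Notation expE eta := (wexp nu (dens eta)).
Notation m := (exp_mean nu h T A).
Notation V := (exp_cov nu h T A).

Lemma centred_mgf eta v : H (eta + v) ->
  expE eta (fun x => expR (dot v (centred_statistic nu h T A eta x))) =
  expR (A (eta + v) - A eta - dot v (m eta)).
Proof.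
move=> Hv; have := expectation_centred_shift (density_integrable fam Hv).
rewrite (density_total fam Hv) mulr1 => <-.
by congr (wexp _ _ _); apply/funext => x; rewrite mul1r.
Qed.

Lemma centred_mgf_expansion eta : H eta -> exists C delta : R,
  [/\ 0 <= C, 0 < delta & forall v, `|v| <= delta -> H (eta + v) /\
  `|expR (A (eta + v) - A eta - dot v (m eta)) - 1
    - 2^-1 * dot v (V eta *m v)| <= C * `|v| ^+ 3].
Proof.
move=> He; have [e e0 eH] := open_closed_ball (ef_open fam) He.
have [b b0 bY] := exp_norm_centred_integrable fam He.
have [C [delta [C0 d0 hC]]] := mgf_expansion (density_measurable fam eta)
  (density_ge0 fam eta) (centred_measurable fam eta) b0 bY
  (density_total fam He) (fun i => centred_mean0 fam i He).
exists C, (Num.min e delta); split=> // [|v].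
  by rewrite lt_min e0.
rewrite le_min => /andP[ve vd]; have Hv := eH _ ve; split=> //.
by rewrite -centred_mgf//; exact: hC.
Qed.

(** Taking the logarithm of the centred moment generating function: its
    deviation [y] from 1 is of order two, so that [ln (1 + y)] and [y] differ by
    a term of order four. *)
Lemma log_normalizer_taylor2 eta : H eta -> exists C delta : R,
  [/\ 0 <= C, 0 < delta & forall v, `|v| <= delta -> H (eta + v) /\
  `|A (eta + v) - A eta - dot v (m eta) - 2^-1 * dot v (V eta *m v)|
    <= C * `|v| ^+ 3].
Proof.
move=> He; have [C [delta [C0 d0 hC]]] := centred_mgf_expansion He.
have [c c0 hc] := exp_cov_norm_le nu h T A eta.
pose K := C + c; have K0 : 0 <= K by rewrite addr_ge0.
(* the last radius makes [`|expR L - 1| <= 2^-1] below *)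
exists (C + 2 * K ^+ 2), (Num.min delta (Num.min 1 (2 * (K + 1))^-1)).
split=> [||v]; first by rewrite addr_ge0// mulr_ge0// exprn_ge0.
  by rewrite !lt_min d0 ltr01 invr_gt0 mulr_gt0// ltr_wpDl.
rewrite !le_min => /and3P[vd v1 vK].
have [Hv {}hC] := hC _ vd; split=> //.
set L := _ - dot _ _ in hC *; set q := 2^-1 * _ in hC *.
have {hc} hq : `|q| <= c * `|v| ^+ 2 by have [] := hc v.
set t := `|v| in vd v1 vK hC hq *.
have t0 : 0 <= t by exact: normr_ge0.
have t2 : 0 <= t ^+ 2 by exact: sqr_ge0.
have t32 : t ^+ 3 <= t ^+ 2 by rewrite exprS ler_piMl.
pose y := expR L - 1.
have hy : `|y| <= K * t ^+ 2.
  have -> : y = (expR L - 1 - q) + q by rewrite subrK.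
  apply: le_trans (ler_normD _ _) _; rewrite mulrDl lerD//.
  by apply: le_trans hC _; rewrite ler_wpM2l.
have y2 : `|y| <= 2^-1.
  apply: le_trans hy _.
  apply: (@le_trans _ _ ((K + 1) * t)).
    rewrite expr2 mulrA ler_wpM2r// (@le_trans _ _ (K * 1))// ?ler_wpM2l//.
    by rewrite mulr1 lerDl.
  rewrite -ler_pdivlMl; last by rewrite ltr_wpDl.
  by rewrite -invfM mulrC.
have hL : `|L - y| <= 2 * K ^+ 2 * t ^+ 3.
  have -> : L = ln (1 + y) by rewrite /y addrC subrK expRK.
  apply: le_trans (ln1D_bound y2) _.
  rewrite -mulrA ler_wpM2l// -real_normK ?num_real//.
  have t43 : (t ^+ 2) ^+ 2 <= t ^+ 3.
    by rewrite -exprM (exprS _ 3) ler_piMl// exprn_ge0.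
  apply: (@le_trans _ _ ((K * t ^+ 2) ^+ 2)).
    by rewrite lerXn2r// nnegrE mulr_ge0.
  by rewrite exprMn ler_wpM2l// exprn_ge0.
have -> : L - q = (L - y) + (y - q) by ring.
apply: le_trans (ler_normD _ _) _; rewrite mulrDl addrC lerD//.
Qed.

Lemma log_normalizer_taylor1 eta : H eta -> exists C delta : R,
  [/\ 0 <= C, 0 < delta & forall v, `|v| <= delta -> H (eta + v) /\
  `|A (eta + v) - A eta - dot v (m eta)| <= C * `|v| ^+ 2].
Proof.
move=> He; have [C [delta [C0 d0 hC]]] := log_normalizer_taylor2 He.
have [c c0 hc] := exp_cov_norm_le nu h T A eta.
exists (C + c), (Num.min delta 1); split=> [||v]; first exact: addr_ge0.
  by rewrite lt_min d0/=.
rewrite le_min => /andP[vd v1]; have [Hv {}hC] := hC _ vd; split=> //.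
have [_ hq] := hc v.
rewrite -(subrK (2^-1 * dot v (V eta *m v)) (_ - dot _ _)).
apply: le_trans (ler_normD _ _) _; rewrite mulrDl lerD//.
apply: le_trans hC _; rewrite ler_wpM2l// exprS ler_piMl// ?exprn_ge0.
Qed.

Lemma gradient_log_normalizer eta : H eta -> gradient A eta = m eta.
Proof.
move=> He; have [C [delta [C0 d0 hC]]] := log_normalizer_taylor1 He.
apply/colP => i; rewrite mxE; apply: (partial_taylor d0 (C := C)) => v vd.
by have [] := hC _ vd.
Qed.

(** The mean at [eta + v] is a quotient of two integrals at [eta].  After
    centring at [m eta], the numerator is [V eta *m v] up to order two and the
    denominator [F] is 1 up to order two, so that only the numerator
    contributes. *)
Lemma mean_taylor1 eta i : H eta -> exists C delta : R,
  [/\ 0 <= C, 0 < delta & forall v, `|v| <= delta -> H (eta + v) /\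
  `|m (eta + v) i 0 - m eta i 0 - (V eta *m v) i 0| <= C * `|v| ^+ 2].
Proof.
move=> He.
have [b b0 bY] := exp_norm_centred_integrable fam He.
have [C1 [d1 [C10 d10 hC1]]] := tilted_mean_expansion
  (density_measurable fam eta) (density_ge0 fam eta)
  (centred_measurable fam eta) b0 bY
  (fun i => centred_mean0 fam i He).
have [C2 [d2 [C20 d20 hC2]]] := centred_mgf_expansion He.
have [c c0 hc] := exp_cov_norm_le nu h T A eta.
pose K := C2 + c; have K0 : 0 <= K by rewrite addr_ge0.
exists (2 * (C1 + K * c)),
  (Num.min (Num.min d1 d2) (Num.min 1 (2 * (K + 1))^-1)).
split=> [||v]; first by rewrite mulr_ge0// addr_ge0// mulr_ge0.
  by rewrite !lt_min d10 d20 ltr01 invr_gt0 mulr_gt0// ltr_wpDl.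
rewrite !le_min => /andP[/andP[vd1 vd2] /andP[v1 vK]].
have [Hv {}hC2] := hC2 _ vd2; split=> //.
have {hc} [hVv hq] := hc v.
have {hVv} := le_trans (coord_le_norm _ i) hVv.
have := hC1 v i vd1.
have [iY eY] := expectation_centred fam eta i Hv.
have -> := expectation_centred_shift iY.
rewrite eY.
set F := expR _ in hC2 *; set B := (_ *m v) i 0 => hB Bv.
rewrite -/B in hB.
set D := m _ i 0 - m _ i 0 in hB *.
set q := 2^-1 * _ in hC2 hq.
set t := `|v| in vd1 vd2 v1 vK hC2 hq hB Bv *.
have t0 : 0 <= t by exact: normr_ge0.
have t2 : 0 <= t ^+ 2 by exact: sqr_ge0.
have t32 : t ^+ 3 <= t ^+ 2 by rewrite exprS ler_piMl.
have hF : `|F - 1| <= K * t ^+ 2.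
  have -> : F - 1 = (F - 1 - q) + q by rewrite subrK.
  apply: le_trans (ler_normD _ _) _; rewrite mulrDl lerD//.
  by apply: le_trans hC2 _; rewrite ler_wpM2l.
have F2 : 2^-1 <= F.
  have : `|F - 1| <= 2^-1.
    apply: le_trans hF _.
    apply: (@le_trans _ _ ((K + 1) * t)).
      rewrite expr2 mulrA ler_wpM2r// (@le_trans _ _ (K * 1))// ?ler_wpM2l//.
      by rewrite mulr1 lerDl.
    rewrite -ler_pdivlMl; last by rewrite ltr_wpDl.
    by rewrite -invfM mulrC.
  by rewrite ler_norml => /andP[+ _]; clear; lra.
have F0 : 0 < F by apply: lt_le_trans F2; rewrite invr_gt0.
have e : F * (D - B) = (F * D - B) - (F - 1) * B by ring.
have hFD : `|F * (D - B)| <= (C1 + K * c) * t ^+ 2.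
  rewrite e; apply: le_trans (ler_normB _ _) _.
  rewrite [leRHS]mulrDl lerD// normrM.
  apply: le_trans (ler_pM _ _ hF Bv) _ => //.
  rewrite (_ : K * t ^+ 2 * (c * t) = K * c * t ^+ 3); last by ring.
  by rewrite ler_wpM2l// mulr_ge0.
move: hFD; rewrite normrM (gtr0_norm F0) => hFD.
have : 2^-1 * `|D - B| <= (C1 + K * c) * t ^+ 2.
  by apply: le_trans hFD; rewrite ler_wpM2r.
by rewrite ler_pdivrMl// mulrA.
Qed.

(** The partial derivatives of [A] agree with the mean on the open set [H] only;
    that suffices, as a second partial derivative is a local quantity. *)
Lemma hessian_log_normalizer eta : H eta -> hessian A eta = V eta.
Proof.
move=> He; apply/matrixP => i j; rewrite mxE.
have pm eta' : H eta' -> partial j A eta' = m eta' j 0.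
  by move=> He'; rewrite -gradient_log_normalizer// mxE.
have [C [delta [C0 d0 hC]]] := mean_taylor1 j He.
have sV : (V eta)^T = V eta by exact: second_moment_sym.
have -> : V eta i j = (\col_k V eta j k) i 0 by rewrite mxE -{1}sV mxE.
apply: (partial_taylor d0 (C := C)) => v vd; have [Hv {}hC] := hC _ vd.
rewrite !pm//; congr (`| _ - _| <= _): hC.
by rewrite mxE dotE; apply: eq_bigr => k _; rewrite mxE mulrC.
Qed.

(** Up to the factor [expR (A z - a)], the density at the intermediate parameter
    [z] is a weighted geometric mean of the two others, hence at most their
    weighted arithmetic mean; integrating gives the inequality.  The segment
    between the two parameters may leave [H], hence the condition on the
    intermediate point. *)
Lemma log_normalizer_convex eta eta' (t : R) : H eta -> H eta' ->
  H ((1 - t) *: eta + t *: eta') -> 0 <= t -> t <= 1 ->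
  A ((1 - t) *: eta + t *: eta') <= (1 - t) * A eta + t * A eta'.
Proof.
move=> He He' Hm t0 t1.
set z := _ + _ in Hm *; set a := (1 - t) * A eta + t * A eta'.
have amgm (x y : R) :
    expR ((1 - t) * x + t * y) <= (1 - t) * expR x + t * expR y.
  pose s := (1 - t) * x + t * y.
  have hx := expR_ge1Dx (x - s); have hy := expR_ge1Dx (y - s).
  have -> : expR x = expR s * expR (x - s) by rewrite -expRD addrC subrK.
  have -> : expR y = expR s * expR (y - s) by rewrite -expRD addrC subrK.
  have -> : (1 - t) * (expR s * expR (x - s)) + t * (expR s * expR (y - s)) =
    expR s * ((1 - t) * expR (x - s) + t * expR (y - s)) by ring.
  rewrite -[leLHS]mulr1 ler_wpM2l ?expR_ge0//.
  rewrite [leLHS](_ : 1 = (1 - t) * (1 + (x - s)) + t * (1 + (y - s))).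
    by apply: lerD; rewrite ler_wpM2l// subr_ge0.
  by rewrite /s; ring.
have int1 eta0 : H eta0 -> nu.-integrable setT (EFin \o dens eta0).
  move=> H0; apply: eq_integrable (density_integrable fam H0) => // x _.
  by rewrite /= mul1r.
have tot eta0 : H eta0 -> \int[nu]_x dens eta0 x = 1.
  move=> H0; rewrite -(density_total fam H0).
  by apply: eq_Rintegral => x _; rewrite mul1r.
have pt x : expR (A z - a) * dens z x <= (1 - t) * dens eta x + t * dens eta' x.
  rewrite /exp_density !(mulrCA _ (h x)) -mulrDr ler_wpM2l ?(ef_h_ge0 fam)//.
  rewrite -expRD; apply: le_trans (amgm _ _); rewrite ler_expR.
  rewrite -/(dot z (T x)) -/(dot eta (T x)) -/(dot eta' (T x)).
  rewrite /z dotDl !dotZl /a -/z le_eqVlt; apply/orP; left; apply/eqP; ring.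
have : \int[nu]_x (expR (A z - a) * dens z x) <=
    \int[nu]_x ((1 - t) * dens eta x + t * dens eta' x).
  apply: le_Rintegral => //.
  - exact: (integrableZl _ _ (int1 _ Hm)).
  - exact: (integrableD _ (integrableZl _ (1 - t) (int1 _ He))
                          (integrableZl _ t (int1 _ He'))).
rewrite RintegralZl//; last exact: int1.
rewrite RintegralD//; last 2 first.
- exact: (integrableZl _ (1 - t) (int1 _ He)).
- exact: (integrableZl _ t (int1 _ He')).
rewrite !RintegralZl ?int1//.
rewrite !tot// !mulr1 subrK -expR0 ler_expR; lra.
Qed.

Lemma exp_cov_psd eta : H eta -> psd (V eta).
Proof.
move=> He; have [b b0 bY] := exp_norm_centred_integrable fam He.
exact: (second_moment_psd (density_measurable fam eta) (density_ge0 fam eta)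
  (centred_measurable fam eta) b0 bY).
Qed.

End log_normalizer.

(** * Maximisers of a convexly penalised linear functional *)

Section argmax.
Context {R : realType} {p : nat}.
Implicit Types (eta u v d : 'cV[R]_p).

Lemma norm_trmx_le (k l : nat) (M : 'M[R]_(k, l)) : `|M^T| <= `|M|.
Proof.
rewrite (_ : `|M^T| = mx_norm M^T)// (_ : `|M| = mx_norm M)// !mx_normrE.
apply/bigmax_leP; split=> [|[i j] _]; first exact: bigmax_ge_id.
by rewrite mxE; exact: (le_bigmax _ (fun ij => `|M ij.1 ij.2|) (j, i)).
Qed.

(** Continuity in terms of the norm, which is what Taylor bounds provide. *)
Definition pointwise_continuous_at (f : 'cV[R]_p -> R) u :=
  forall e : R, 0 < e -> exists2 d : R, 0 < d &
    forall v, `|v| <= d -> `|f (u + v) - f u| <= e.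

(** The extreme value theorem, with Heine-Borel applied to row vectors:
    transposition preserves the norm. *)
Lemma closed_ball_argmax (f : 'cV[R]_p -> R) u (r : R) : 0 < r ->
  (forall v, `|v - u| <= r -> pointwise_continuous_at f v) ->
  exists2 v, `|v - u| <= r & forall v', `|v' - u| <= r -> f v' <= f v.
Proof.
move=> r0 fc.
pose B : set 'rV[R]_p := [set x | `|x - u^T| <= r].
have uB x : B x -> `|x^T - u| <= r.
  move=> Bx; rewrite -(trmxK u) -linearB/=.
  exact: le_trans (norm_trmx_le _) Bx.
have Bu v : `|v - u| <= r -> B v^T.
  by move=> vr; rewrite /B/= -linearB/=; exact: le_trans (norm_trmx_le _) vr.
have cB : compact B.
  apply: bounded_closed_compact.
    exists (r + `|u^T|); split; first by rewrite num_real.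
    move=> M rM x Bx; apply: le_trans (ltW rM).
    rewrite -(subrK u^T x); apply: le_trans (ler_normD _ _) _.
    by rewrite lerD2r.
  have -> : B = closed_ball u^T r.
    by rewrite closed_ballE//; apply/seteqP; split=> x; rewrite /B/= distrC.
  exact: closed_ball_closed.
have cf (x : 'rV[R]_p) : B x -> {for x, continuous (f \o trmx)}.
  move=> Bx P /nbhs_ballP[e /= e0 eP]; have e2 : 0 < e / 2 by rewrite divr_gt0.
  have [dl dl0 hd] := fc _ (uB _ Bx) _ e2.
  apply/nbhs_ballP; exists dl => //= y; rewrite mx_norm_ball /ball_/= => xy.
  apply: eP; rewrite -ball_normE /ball_/= distrC.
  apply: le_lt_trans (_ : _ <= e / 2) _; last first.
    by rewrite ltr_pdivrMr// ltr_pMr// ltr1n.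
  rewrite [in X in X - _](_ : y^T = x^T + (y^T - x^T)); last first.
    by rewrite addrC subrK.
  apply: hd.
  rewrite -linearB/=; apply: le_trans (norm_trmx_le _) _.
  by rewrite distrC ltW.
have [||w wB wmax] := compact_EVT_max (f := f \o trmx) _ cB.
- by exists u^T; rewrite /B/= subrr normr0 ltW.
- by apply: continuous_in_subspaceT => x; rewrite inE => /cf.
exists w^T => [|v vr]; first by apply: uB; rewrite inE in wB.
by rewrite -[v]trmxK; apply: wmax; rewrite inE; exact: Bu.
Qed.

Let quadratic_gap (x y z a1 a2 a3 a4 b1 b2 b3 b4 b5 : R) : b2 <= y ->
  2 * b1 < 2^-1 * b2 ->
  - b1 <= b3 - b5 - a4 - 2^-1 * z -> b3 - b5 - a4 - 2^-1 * z <= b1 ->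
  - b1 <= b4 - b5 - (a4 + a3) - 2^-1 * (z + x + (x + y)) ->
  b4 - b5 - (a4 + a3) - 2^-1 * (z + x + (x + y)) <= b1 ->
  a2 + (a4 + a3) + (a1 + (z + x)) - b4 < a2 + a1 + (a4 + z) - b3.
Proof. lra. Qed.

Let chord_gap (t z a b x y : R) : z <= (1 - t) * a + t * b ->
  (1 - t) * x + t * y - z < x - a -> t * y - t * b < t * x - t * a.
Proof. lra. Qed.

Variables (H : set 'cV[R]_p) (A : 'cV[R]_p -> R) (eta0 g vs : 'cV[R]_p)
  (V : 'M[R]_p) (C delta lam e : R).
Hypothesis cvxA : forall eta eta' (t : R), H eta -> H eta' ->
  H ((1 - t) *: eta + t *: eta') -> 0 <= t -> t <= 1 ->
  A ((1 - t) *: eta + t *: eta') <= (1 - t) * A eta + t * A eta'.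
Hypothesis contA : forall eta, H eta -> pointwise_continuous_at A eta.
Hypothesis C0 : 0 <= C.
Hypothesis taylorA : forall v, `|v| <= delta -> H (eta0 + v) /\
  `|A (eta0 + v) - A eta0 - dot v g - 2^-1 * dot v (V *m v)| <= C * `|v| ^+ 3.
Hypothesis symV : V^T = V.
Hypothesis coerciveV : forall u, lam * `|u| ^+ 2 <= dot u (V *m u).
Hypotheses (e0 : 0 < e) (ve : `|vs| + e <= delta).
(* the gain [lam * e ^+ 2 / 2] of the quadratic part on the sphere of radius [e]
   exceeds the two cubic remainders, at the centre and on the sphere *)
Hypothesis small : 2 * (C * (`|vs| + e) ^+ 3) < 2^-1 * (lam * e ^+ 2).

(** The log-likelihood per observation, without the term in [h], for a sample
    whose statistics have mean [tau]. *)
Definition tilted_objective (tau eta : 'cV[R]_p) : R := dot eta tau - A eta.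

(* by the Taylor expansion, [J] is close to a concave quadratic function with
   maximum at [c] *)
Let J := tilted_objective (g + V *m vs).
Let c := eta0 + vs.

Let sphere d : `|d| = e -> J (c + d) < J c.
Proof.
move=> de.
have vd1 : `|vs + d| <= `|vs| + e by rewrite -de ler_normD.
have [_ h1] := taylorA (le_trans vd1 ve).
have [_ h2] := taylorA (le_trans (ler_wpDr (ltW e0) (lexx _)) ve).
have k1 : C * `|vs + d| ^+ 3 <= C * (`|vs| + e) ^+ 3.
  by rewrite ler_wpM2l//; apply: lerXn2r => //;
    rewrite nnegrE ?addr_ge0 ?(ltW e0).
have k2 : C * `|vs| ^+ 3 <= C * (`|vs| + e) ^+ 3.
  by rewrite ler_wpM2l// lerXn2r ?nnegrE ?addr_ge0 ?(ltW e0)// lerDl ltW.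
have := coerciveV d; rewrite de => k3.
have := le_trans h1 k1; have := le_trans h2 k2.
rewrite /J /tilted_objective /c -(addrA eta0) !mulmxDr !(dotDl, dotDr).
rewrite (dot_sym vs d symV) !ler_norml => /andP[+ +] /andP[+ +].
move: k3 small.
exact: quadratic_gap.
Qed.

Let inH v : `|v - c| <= e -> H v.
Proof.
move=> vc; have [|+ _] := @taylorA (v - c + vs).
  apply: le_trans ve; rewrite [leRHS]addrC; apply: le_trans (ler_normD _ _) _.
  by rewrite lerD2r.
by rewrite (_ : eta0 + _ = v)// addrCA -/c subrK.
Qed.

(** A chord from [c] to a point outside the ball crosses the sphere, where [J]
    is below [J c]; by concavity [J] is below [J c] at its end as well.  This is
    what turns the local expansion into a statement about all of [H]. *)
Let outside eta : H eta -> e < `|eta - c| -> J eta < J c.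
Proof.
move=> He ec; set n := `|eta - c| in ec.
have n0 : 0 < n by exact: lt_trans ec.
pose t := e / n.
have t0 : 0 < t by rewrite divr_gt0.
have t1 : t <= 1 by rewrite ler_pdivrMr// mul1r ltW.
have zE : (1 - t) *: c + t *: eta = c + t *: (eta - c).
  by rewrite scalerBl scale1r scalerBr addrAC -addrA.
have de : `|t *: (eta - c)| = e.
  by rewrite normrZ gtr0_norm// -/n /t divfK// gt_eqF.
have Hc : H c by apply: inH; rewrite subrr normr0 ltW.
have Hz : H ((1 - t) *: c + t *: eta).
  by apply: inH; rewrite zE addrC addKr de.
have hJ := sphere de; rewrite -zE in hJ.
have hA := cvxA Hc He Hz (ltW t0) t1.
rewrite -(ltr_pM2l t0); move: hA hJ.
by rewrite /J /tilted_objective dotDl !dotZl !mulrBr; exact: chord_gap.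
Qed.

Lemma tilted_argmax_exists :
  exists eta, H eta /\ forall eta', H eta' -> J eta' <= J eta.
Proof.
have [v /inH Hv r r0|v vc vmax] := @closed_ball_argmax J c e e0.
  have r20 : 0 < r / 2 by rewrite divr_gt0.
  have [d d0 hd] := contA Hv r20.
  pose tau := g + V *m vs.
  have k0 : 0 < p%:R * `|tau| + 1 by rewrite ltr_wpDl// mulr_ge0.
  exists (Num.min d (r / 2 / (p%:R * `|tau| + 1))).
    by rewrite lt_min d0 divr_gt0.
  move=> w; rewrite le_min => /andP[wd wr].
  rewrite /J /tilted_objective -/tau dotDl [X in `|X|](_ : _ =
    dot w tau - (A (v + w) - A v)); last by ring.
  apply: le_trans (ler_normB _ _) _.
  rewrite [leRHS]splitr lerD ?hd//; apply: le_trans (dot_le _ _) _.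
  apply: (@le_trans _ _ (`|w| * (p%:R * `|tau| + 1))).
    by rewrite mulrDr mulr1 mulrCA lerDl.
  by rewrite -ler_pdivlMr.
exists v; split; first exact: inH.
move=> eta' He'; have [ec|ec] := leP `|eta' - c| e; first exact: vmax.
apply: le_trans (ltW (outside He' ec)) _; apply: vmax.
by rewrite subrr normr0 ltW.
Qed.

Lemma tilted_argmax_near eta : H eta ->
  (forall eta', H eta' -> J eta' <= J eta) -> `|eta - eta0 - vs| <= e.
Proof.
move=> He emax; rewrite -addrA -opprD -/c leNgt; apply/negP => ec.
have := outside He ec; rewrite ltNge emax//.
by apply: inH; rewrite subrr normr0 ltW.
Qed.

End argmax.

(** * The likelihood and its maximisers *)

Section likelihood.
Context {R : realType} {Omega : pmetricType R} {p : nat}.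
Variables (H : set 'cV[R]_p)
  (h : Omega -> R) (T : Omega -> 'cV[R]_p) (A : 'cV[R]_p -> R).

Lemma likelihoodE n (x : 'I_n -> Omega) eta : (0 < n)%N ->
  likelihood h T A x eta = (\prod_i h (x i)) *
    expR (n%:R * tilted_objective A (n%:R^-1 *: \sum_i T (x i)) eta).
Proof.
move=> n0; rewrite /likelihood /exp_density big_split/= -expR_sum.
congr (_ * expR _); rewrite /tilted_objective dotZr dot_sumr mulrBr.
rewrite mulVKf; last by rewrite pnatr_eq0 -lt0n.
by rewrite big_split/= sumrN sumr_const card_ord mulr_natl.
Qed.

Lemma likelihood_maximizerE n (x : 'I_n -> Omega) eta : (0 < n)%N ->
  (forall i, 0 < h (x i)) ->
  let J := tilted_objective A (n%:R^-1 *: \sum_i T (x i)) in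
  likelihood_maximizer H h T A x eta <->
  H eta /\ forall eta', H eta' -> J eta' <= J eta.
Proof.
move=> n0 hx J; have h0 : 0 < \prod_i h (x i) by apply: prodr_gt0.
have le_iff eta1 eta2 :
    (likelihood h T A x eta1 <= likelihood h T A x eta2) = (J eta1 <= J eta2).
  by rewrite !likelihoodE// ler_pM2l// ler_expR ler_pM2l// ltr0n.
by split=> -[He Hm]; split=> // eta' /Hm; rewrite le_iff.
Qed.

End likelihood.

Section maximum_likelihood.
Context {R : realType} {Omega : pmetricType R} {p : nat}.
Variables (nu : {measure set (borelType Omega) -> \bar R}) (H : set 'cV[R]_p)
  (h : Omega -> R) (T : Omega -> 'cV[R]_p) (A : 'cV[R]_p -> R).
Hypothesis fam : exp_family nu H h T A.
Implicit Types eta v : 'cV[R]_p.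

Notation m := (exp_mean nu h T A).
Notation V := (exp_cov nu h T A).

Lemma log_normalizer_continuous eta : H eta -> pointwise_continuous_at A eta.
Proof.
move=> He e e0; have [C [delta [C0 d0 hC]]] := log_normalizer_taylor1 fam He.
pose k := C + p%:R * `|m eta| + 1.
have k0 : 0 < k by rewrite ltr_wpDl// addr_ge0// mulr_ge0.
exists (Num.min delta (Num.min 1 (e / k))).
  by rewrite !lt_min d0 ltr01 divr_gt0.
move=> v; rewrite !le_min => /and3P[vd v1 ve].
have [_ {}hC] := hC _ vd.
rewrite -(subrK (dot v (m eta)) (A (eta + v) - A eta)).
apply: le_trans (ler_normD _ _) _.
apply: (@le_trans _ _ (`|v| * k)); last by rewrite -ler_pdivlMr.
apply: (@le_trans _ _ (C * `|v| ^+ 2 + p%:R * (`|v| * `|m eta|))).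
  by rewrite lerD// dot_le.
have v2 : C * `|v| ^+ 2 <= C * `|v|.
  by rewrite ler_wpM2l// expr2 ler_piMl.
have -> : `|v| * k = C * `|v| + p%:R * (`|v| * `|m eta|) + `|v|.
  by rewrite /k; ring.
by rewrite ler_wpDr// lerD2r.
Qed.

(** With [s] the square root of [n], the perturbation of [tau] has size
    [K / s].  The tolerance [e] is [eps / s], so the quadratic gap is of order
    [s ^- 2] and the cubic remainder of order [s ^- 3]: the gap wins once [s]
    exceeds a threshold depending on [K] and [eps] only. *)
Lemma maximizer_near_newton_step eta0 (K eps : R) : H eta0 ->
  V eta0 \in unitmx -> 0 <= K -> 0 < eps -> exists M : R, forall n, (0 < n)%N ->
  M < Num.sqrt n%:R -> forall u tau : 'cV[R]_p, `|u| <= K ->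
  tau = m eta0 + (Num.sqrt n%:R)^-1 *: u ->
  let J := tilted_objective A tau in
  (exists eta, H eta /\ forall eta', H eta' -> J eta' <= J eta) /\
  forall eta, H eta -> (forall eta', H eta' -> J eta' <= J eta) ->
    `|Num.sqrt n%:R *: (eta - eta0) - invmx (V eta0) *m u| <= eps.
Proof.
move=> H0 uV K0 e0.
have [C [delta [C0 d0 hC]]] := log_normalizer_taylor2 fam H0.
have sV : (V eta0)^T = V eta0 by exact: second_moment_sym.
have pV : psd (V eta0) by exact: (exp_cov_psd fam).
have [lam lam0 hlam] := psd_unitmx_coercive sV pV uV.
have [c c0 hc] := mulmx_norm_bound (invmx (V eta0)).
pose B := c * K + eps.
have B0 : 0 < B by rewrite ltr_wpDl// mulr_ge0.
exists (Num.max (B / delta) (4 * C * B ^+ 3 / (lam * eps ^+ 2))).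
move=> n n0; set s := Num.sqrt _; rewrite gt_max => /andP[s1 s2].
move=> u tau uK tauE J.
have s0 : 0 < s by apply: lt_trans s1; rewrite divr_gt0.
pose vs := s^-1 *: (invmx (V eta0) *m u).
pose e := eps / s.
have e0' : 0 < e by rewrite divr_gt0.
have vsB : `|vs| + e <= B / s.
  rewrite normrZ normfV (gtr0_norm s0) /e /B mulrDl lerD2r mulrC.
  rewrite ler_pM2r ?invr_gt0//.
  by apply: le_trans (hc u) _; rewrite ler_wpM2l.
have vd : `|vs| + e <= delta.
  by apply: le_trans vsB _; rewrite ler_pdivrMr// mulrC -ler_pdivrMr// ltW.
have small : 2 * (C * (`|vs| + e) ^+ 3) < 2^-1 * (lam * e ^+ 2).
  apply: (@le_lt_trans _ _ (2 * (C * (B / s) ^+ 3))).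
    rewrite ler_wpM2l// ler_wpM2l// lerXn2r// nnegrE.
      by rewrite addr_ge0// ltW.
    by rewrite divr_ge0// ltW.
  have -> : 2 * (C * (B / s) ^+ 3) = 2 * C * B ^+ 3 / s / s ^+ 2.
    by field; rewrite gt_eqF.
  have -> : 2^-1 * (lam * e ^+ 2) = 2^-1 * (lam * eps ^+ 2) / s ^+ 2.
    by rewrite /e; field; rewrite gt_eqF.
  rewrite ltr_pM2r ?invr_gt0 ?exprn_gt0// ltr_pdivrMr//.
  move: s2; rewrite ltr_pdivrMr ?mulr_gt0 ?exprn_gt0// => s2.
  rewrite (_ : _ * s = 2^-1 * (s * (lam * eps ^+ 2))); last by ring.
  rewrite ltr_pdivlMl//; apply: le_lt_trans s2.
  by rewrite le_eqVlt (_ : 2 * (2 * C * B ^+ 3) = 4 * C * B ^+ 3) ?eqxx//; ring.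
have tauE' : tau = m eta0 + V eta0 *m vs.
  by rewrite tauE /vs -scalemxAr mulKVmx.
have cvx := log_normalizer_convex fam.
have cont := log_normalizer_continuous.
rewrite /J tauE'; split.
  exact: (tilted_argmax_exists cvx cont C0 hC sV hlam e0' vd small).
move=> eta He Hm.
have := tilted_argmax_near cvx C0 hC sV hlam e0' vd small He Hm.
move=> h1.
have -> : s *: (eta - eta0) - invmx (V eta0) *m u = s *: (eta - eta0 - vs).
  by rewrite [RHS]scalerBr /vs scalerA divff ?scale1r// gt_eqF.
by rewrite normrZ gtr0_norm// mulrC -ler_pdivlMr.
Qed.

End maximum_likelihood.

(** * Integration against a density *)

Section density.
Context {d} {S : measurableType d} {R : realType}.
Variables (nu : {measure set S -> \bar R}) (mu : {measure set S -> \bar R}).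
Variable f : S -> R.
Hypotheses (mf : measurable_fun [set: S] f) (f0 : forall x, 0 <= f x).
Hypothesis muE : forall B, measurable B ->
  mu B = (\int[nu]_(x in B) (f x)%:E)%E.

Import HBNNSimple.

Let mfE : measurable_fun [set: S] (EFin \o f).
Proof. exact/measurable_EFinP. Qed.

Let nnsfun_density (g : {nnsfun S >-> R}) :
  (\int[mu]_x (g x)%:E = \int[nu]_x ((g x)%:E * (f x)%:E))%E.
Proof.
have gE x : (g x)%:E =
    (\sum_(y \in range g) y%:E * (\1_(g @^-1` [set y]) x)%:E)%E.
  by rewrite [in LHS]fimfunE -fsumEFin//.
have m1 y : measurable_fun [set: S] (fun x => (\1_(g @^-1` [set y]) x)%:E).
  by apply/measurable_EFinP; exact: measurable_indic.
have y0 y : range g y -> (0 <= y%:E)%E by move=> [x _ <-]; rewrite lee_fin.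
have g0 y x : (0 <= y%:E * (\1_(g @^-1` [set y]) x)%:E)%E.
  have [gx|gx] := pselect (g x = y).
    by rewrite -gx mule_ge0// lee_fin.
  by rewrite indicE memNset//= mule0.
under eq_integral do rewrite gE.
under [RHS]eq_integral => x _.
  rewrite gE (ge0_mule_fsuml _ _ (fun y => g0 y x)).
  over.
rewrite ge0_integral_fsum//; last by move=> y; exact: emeasurable_funM.
rewrite ge0_integral_fsum//; last first.
- by move=> y x _; rewrite mule_ge0// lee_fin.
- by move=> y; apply: emeasurable_funM => //; exact: emeasurable_funM.
apply: eq_fsbigr => y /set_mem yg.
under [RHS]eq_integral do rewrite -muleA.
rewrite !ge0_integralZl//=; last 4 first.
- exact: emeasurable_funM.
- by move=> x _; rewrite mule_ge0// lee_fin.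
- exact: y0.
- exact: y0.
rewrite integral_indic// setIT muE//; congr (_ * _)%E.
rewrite integral_mkcond; apply: eq_integral => x _.
rewrite patchE indicE; case: ifPn => _; first by rewrite mul1e.
by rewrite mul0e.
Qed.

(** Monotone convergence reduces this to simple functions, and linearity to
    indicators, where it is the hypothesis on [mu]. *)
Lemma ge0_integral_density (g : S -> \bar R) : measurable_fun [set: S] g ->
  (forall x, 0 <= g x)%E -> (\int[mu]_x g x = \int[nu]_x (g x * (f x)%:E))%E.
Proof.
move=> mg g0.
pose a := nnsfun_approx measurableT mg.
have ag x : (a n x)%:E @[n --> \oo] --> g x by exact: cvg_nnsfun_approx.
have nda x : {homo (fun n => (a n x)%:E) : m n / (m <= n)%N >-> (m <= n)%E}.
  by move=> m n mn; rewrite lee_fin; exact/lefP/nd_nnsfun_approx.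
have e1 : (\int[mu]_x g x = limn (fun n => \int[mu]_x (a n x)%:E))%E.
  rewrite -monotone_convergence//=.
  - by apply: eq_integral => x _; apply/esym/cvg_lim.
  - by move=> n; exact/measurable_EFinP.
  - by move=> n x _; rewrite lee_fin.
have e2 : (\int[nu]_x (g x * (f x)%:E) =
    limn (fun n => \int[nu]_x ((a n x)%:E * (f x)%:E)))%E.
  rewrite -monotone_convergence//=.
  - apply: eq_integral => x _; apply/esym/cvg_lim => //.
    by apply: cvgeZr.
  - by move=> n; apply: emeasurable_funM => //; exact/measurable_EFinP.
  - by move=> n x _; rewrite mule_ge0// lee_fin.
  - by move=> x _ m n mn; rewrite lee_wpmul2r ?lee_fin// -lee_fin; exact: nda.
by rewrite e1 e2; congr (limn _); apply/funext => n; exact: nnsfun_density.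
Qed.

Lemma integrable_density (g : S -> R) : measurable_fun [set: S] g ->
  wint nu f g -> mu.-integrable setT (EFin \o g).
Proof.
move=> mg /integrableP[_ gfoo]; apply/integrableP; split.
  exact/measurable_EFinP.
rewrite ge0_integral_density//; last first.
  by apply: measurableT_comp => //; exact/measurable_EFinP.
apply: le_lt_trans gfoo; rewrite le_eqVlt; apply/orP; left; apply/eqP.
by apply: eq_integral => x _; rewrite /= normrM (ger0_norm (f0 x)).
Qed.

Lemma Rintegral_density (g : S -> R) : measurable_fun [set: S] g ->
  wint nu f g -> \int[mu]_x g x = wexp nu f g.
Proof.
move=> mg gi.
have ai : wint nu f (fun x => `|g x|).
  apply: eq_integrable (integrable_norm gi) => // x _.
  by rewrite /= normrM (ger0_norm (f0 x)).
have nn (k : S -> R) : measurable_fun [set: S] k -> (forall x, 0 <= k x) ->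
    \int[mu]_x k x = wexp nu f k.
  move=> mk k0; congr fine; rewrite ge0_integral_density//.
  exact/measurable_EFinP.
have ma : measurable_fun [set: S] (fun x => `|g x|) by exact: measurableT_comp.
(* a difference of nonnegative functions *)
have gE x : g x = (`|g x| + g x) - `|g x| by rewrite addrC addKr.
transitivity (\int[mu]_x ((`|g x| + g x) - `|g x|)).
  by apply: eq_Rintegral => x _.
have mi := integrable_density mg gi; have mai := integrable_density ma ai.
rewrite RintegralB//; last exact: (integrableD _ mai mi).
rewrite !nn//; [|exact: measurable_funD|]; last first.
  by move=> x; rewrite -lerBlDl sub0r lerNl -normrN ler_norm.
rewrite -wexpB//; last exact: wintD.
by congr wexp; apply/funext => x; rewrite -gE.
Qed.

End density.

(** * Independent pairs *)

Section independent_pair.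
Context {d} {W : measurableType d} {R : realType} {P : probability W R}.
Context {d'} {S : measurableType d'}.
Variables X Y : {RV P >-> S}.
Hypothesis indep : forall A B, measurable A -> measurable B ->
  P (X @^-1` A `&` Y @^-1` B) = (P (X @^-1` A) * P (Y @^-1` B))%E.
Variables phi psi : S -> R.
Hypotheses (iphi : (distribution P X).-integrable setT (EFin \o phi))
  (ipsi : (distribution P Y).-integrable setT (EFin \o psi)).

Let pair_fun w := (X w, Y w).

Let mpair : measurable_fun [set: W] pair_fun.
Proof. exact/measurable_fun_pair. Qed.

HB.instance Definition _ := isMeasurableFun.Build _ _ _ _ pair_fun mpair.

Let XY : {RV P >-> (S * S)%type} := pair_fun.

(* the joint law of an independent pair is a product measure, so that Fubini's
   theorem computes the expectation of a product *)
Let lawE C : measurable C ->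
  (distribution P X \x distribution P Y)%E C = distribution P XY C.
Proof.
by move=> mC; apply: product_measure_unique.
Qed.

Let prodf (z : S * S) := (phi z.1 * psi z.2)%:E.

Let mprodf : measurable_fun [set: S * S] prodf.
Proof.
have mphi : measurable_fun setT phi.
  exact/measurable_EFinP/(measurable_int _ iphi).
have mpsi : measurable_fun setT psi.
  exact/measurable_EFinP/(measurable_int _ ipsi).
by apply/measurable_EFinP; apply: measurable_funM; apply: measurableT_comp.
Qed.

Let iprodf : (distribution P X \x distribution P Y)%E.-integrable setT prodf.
Proof.
apply/integrable12ltyP => //.
have /integrableP[mp pf] := iphi; have /integrableP[mq qf] := ipsi.
have mp' : measurable_fun setT (fun x => (`|phi x|)%:E).
  apply/measurable_EFinP; apply: measurableT_comp => //.
  exact/measurable_EFinP.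
have mq' : measurable_fun setT (fun y => (`|psi y|)%:E).
  apply/measurable_EFinP; apply: measurableT_comp => //.
  exact/measurable_EFinP.
under eq_integral => x _.
  under eq_integral => y _ do rewrite /prodf/= normrM EFinM.
  rewrite ge0_integralZl//.
  over.
rewrite ge0_integralZr//=; last exact: integral_ge0.
by rewrite lte_mul_pinfty ?ge0_fin_numE ?integral_ge0.
Qed.

Let integral_prodf : (\int[distribution P X \x distribution P Y]_z prodf z =
  (\int[distribution P X]_x phi x * \int[distribution P Y]_y psi y)%R%:E)%E.
Proof.
have EY : (\int[distribution P Y]_y (psi y)%:E =
    (\int[distribution P Y]_y psi y)%R%:E)%E.
  by rewrite /Rintegral fineK//; exact: integrable_fin_num.
have EX : (\int[distribution P X]_x (phi x)%:E =
    (\int[distribution P X]_x phi x)%R%:E)%E.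
  by rewrite /Rintegral fineK//; exact: integrable_fin_num.
rewrite -integral12_prod_meas1// EFinM -EX -integralZr//.
apply: eq_integral => x _; rewrite -EY -integralZl//.
Qed.

Lemma independent_integrableM :
  P.-integrable setT (fun w => (phi (X w) * psi (Y w))%:E).
Proof.
have /integrableP[mp pf] := iprodf; apply/integrableP; split.
  exact: (measurableT_comp mprodf mpair).
move: pf; rewrite (eq_measure_integral (distribution P XY)); last first.
  by move=> C mC _; exact: lawE.
rewrite ge0_integral_distribution//; exact: measurableT_comp.
Qed.

Lemma independent_expectationM : \int[P]_w (phi (X w) * psi (Y w)) =
  \int[distribution P X]_x phi x * \int[distribution P Y]_y psi y.
Proof.
rewrite -[RHS]/(fine _%:E) -integral_prodf; congr fine.
rewrite (eq_measure_integral (distribution P XY)); last first.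
  by move=> C mC _; exact: lawE.
by rewrite integral_distribution//; exact: independent_integrableM.
Qed.

End independent_pair.

(** * The normalised score of an iid sample *)

Section uncorrelated_sum.
Context {d} {W : measurableType d} {R : realType} (P : probability W R).
Variables (Z : nat -> W -> R) (s : R).
Hypothesis iZ : forall i k, P.-integrable setT (fun w => (Z i w * Z k w)%:E).
Hypothesis EZ : forall i k,
  \int[P]_w (Z i w * Z k w) = if i == k then s else 0.

Let sqr_sumE n w : (\sum_(i < n) Z i w) ^+ 2 =
  \sum_(i < n) \sum_(k < n) Z i w * Z k w.
Proof.
by rewrite expr2 mulr_suml; apply: eq_bigr => i _; rewrite mulr_sumr.
Qed.

Lemma integrable_sqr_sum n :
  P.-integrable setT (fun w => ((\sum_(i < n) Z i w) ^+ 2)%:E).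
Proof.
under eq_fun do rewrite sqr_sumE.
by apply: integrable_Rsum => i; apply: integrable_Rsum => k; exact: iZ.
Qed.

Lemma Rintegral_sqr_sum n :
  \int[P]_w ((\sum_(i < n) Z i w) ^+ 2) = n%:R * s.
Proof.
under eq_Rintegral do rewrite sqr_sumE.
rewrite Rintegral_sum => [|i]; last by apply: integrable_Rsum => k; exact: iZ.
rewrite (eq_bigr (fun=> s)) => [|i _].
  by rewrite sumr_const card_ord mulr_natl.
rewrite Rintegral_sum => [|k]; last exact: iZ.
rewrite (bigD1 i)//= EZ eqxx big1 ?addr0// => k ki.
by rewrite EZ eq_sym (inj_eq val_inj) (negbTE ki).
Qed.

End uncorrelated_sum.

Section iid_sample.
Context {R : realType} {Omega : pmetricType R} {p : nat}.
Variables (nu : {measure set (borelType Omega) -> \bar R}) (H : set 'cV[R]_p)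
  (h : Omega -> R) (T : Omega -> 'cV[R]_p) (A : 'cV[R]_p -> R).
Hypothesis fam : exp_family nu H h T A.
Context {d : measure_display} {W : measurableType d} {P : probability W R}.
Variables (eta0 : 'cV[R]_p) (X : nat -> {RV P >-> borelType Omega}).
Hypotheses (heta0 : H eta0)
  (hX : iid_with_density nu (exp_density h T A eta0) X).

Notation dens := (exp_density h T A).
Notation m := (exp_mean nu h T A).
Notation V := (exp_cov nu h T A).
Notation Y := (centred_statistic nu h T A eta0).

Lemma pairwise_independent i k (B C : set (borelType Omega)) : i != k ->
  measurable B -> measurable C ->
  P (X i @^-1` B `&` X k @^-1` C) = (P (X i @^-1` B) * P (X k @^-1` C))%E.
Proof.
move=> ik mB mC; have [ind _] := hX.
pose D l := if l == i then B else C.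
have mD l : measurable (D l) by rewrite /D; case: ifP.
have ki : k != i by rewrite eq_sym.
have := ind [fset i; k]%fset D mD.
rewrite big_fsetU1 ?in_fset1//= big_seq_fset1 /D eqxx (negbTE ki) => <-.
congr (P _); apply/seteqP; split=> w /=.
  by move=> [wB wC] l; rewrite /= in_fset2 => /orP[]/eqP -> /=;
    rewrite ?eqxx ?(negbTE ki).
move=> hw; split.
  by have := hw i; rewrite /= eqxx; apply; rewrite in_fset2 eqxx.
by have := hw k; rewrite /= (negbTE ki); apply; rewrite in_fset2 eqxx orbT.
Qed.

Let densityP i B (mB : measurable B) :
  distribution P (X i) B = (\int[nu]_(x in B) (dens eta0 x)%:E)%E :=
  hX.2 i B mB.

Lemma sample_integrable i (f : borelType Omega -> R) :
  measurable_fun setT f -> wint nu (dens eta0) f ->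
  (distribution P (X i)).-integrable setT (EFin \o f).
Proof.
exact: (integrable_density (density_measurable fam eta0) (density_ge0 fam eta0)
  (densityP i)).
Qed.

Lemma sample_expectation i (f : borelType Omega -> R) :
  measurable_fun setT f -> wint nu (dens eta0) f ->
  \int[distribution P (X i)]_x f x = wexp nu (dens eta0) f.
Proof.
exact: (Rintegral_density (density_measurable fam eta0) (density_ge0 fam eta0)
  (densityP i)).
Qed.

Let centred_int j : wint nu (dens eta0) (fun x => Y x j 0).
Proof. by have [] := expectation_centred fam eta0 j heta0. Qed.

Let centred_int2 j : wint nu (dens eta0) (fun x => Y x j 0 * Y x j 0).
Proof.
have [b b0 bY] := exp_norm_centred_integrable fam heta0.
exact: (wint_coord2 (density_measurable fam eta0)
  (centred_measurable fam eta0) b0 bY).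
Qed.

Lemma sample_product_moment j i k :
  P.-integrable setT (fun w => (Y (X i w) j 0 * Y (X k w) j 0)%:E) /\
  \int[P]_w (Y (X i w) j 0 * Y (X k w) j 0) =
    if i == k then V eta0 j j else 0.
Proof.
have mY := centred_measurable fam eta0 j.
have mY2 : measurable_fun setT (fun x : borelType Omega => Y x j 0 * Y x j 0).
  exact: measurable_funM.
have [<-|ik] := eqVneq i k.
  have i2 : P.-integrable setT (fun w => (Y (X i w) j 0 * Y (X i w) j 0)%:E).
    have /integrableP[mm] := sample_integrable i mY2 (centred_int2 j).
    rewrite ge0_integral_distribution//; last exact: measurableT_comp.
    move=> hfin; apply/integrableP; split=> //.
    exact: (measurableT_comp mm (measurable_funP (X i))).
  split=> //.
  rewrite [RHS]mxE -(sample_expectation i mY2 (centred_int2 j)).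
  congr fine; rewrite integral_distribution//.
  exact/measurable_EFinP.
have ind := pairwise_independent ik.
have ii := sample_integrable i mY (centred_int j).
have ik' := sample_integrable k mY (centred_int j).
split; first exact: (independent_integrableM (fun B C => @ind B C) ii ik').
rewrite (independent_expectationM (fun B C => @ind B C) ii ik').
rewrite sample_expectation//.
by rewrite (centred_mean0 fam j heta0) mul0r.
Qed.

Definition score_sum n w : 'cV[R]_p :=
  (Num.sqrt n%:R)^-1 *: \sum_(i < n) (T (X i w) - m eta0).

Lemma sample_statistic_measurable i : measurable_coords (fun w => T (X i w)).
Proof.
move=> j; exact: (measurableT_comp (statistic_coord_measurable fam j)
  (measurable_funP (X i))).
Qed.

Lemma score_sum_measurable n : measurable_coords (score_sum n).
Proof.
apply: measurable_coordsZ; apply: measurable_coords_sum => k.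
apply: measurable_coordsB; last exact: measurable_coords_cst.
exact: sample_statistic_measurable.
Qed.

(** Chebyshev's inequality for the sum of the squared coordinates, whose
    expectation is the trace of the covariance matrix for every [n]. *)
Lemma score_sum_tail n (K : R) : (0 < n)%N -> 0 < K ->
  (P [set w | (K < `|score_sum n w|)%R] <= (\tr (V eta0) / K ^+ 2)%:E)%E.
Proof.
move=> n0 K0.
have n0' : n%:R != 0 :> R by rewrite pnatr_eq0 -lt0n.
pose Z j i w := Y (X i w) j 0.
pose Q w := \sum_j n%:R^-1 * (\sum_(i < n) Z j i w) ^+ 2.
have iZ j i k := (sample_product_moment j i k).1.
have EZ j i k := (sample_product_moment j i k).2.
have iZn j : P.-integrable setT
    (EFin \o (fun w => n%:R^-1 * (\sum_(i < n) Z j i w) ^+ 2)).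
  exact: (integrableZl _ _ (integrable_sqr_sum (iZ j) n)).
have iQ : P.-integrable setT (EFin \o Q) by exact: integrable_Rsum.
have EQ : \int[P]_w Q w = \tr (V eta0).
  rewrite Rintegral_sum//; apply: eq_bigr => j _.
  rewrite RintegralZl//; last exact: (integrable_sqr_sum (iZ j) n).
  by rewrite (Rintegral_sqr_sum (iZ j) (EZ j)) mulKf.
have Q0 w : 0 <= Q w.
  by apply: sumr_ge0 => j _; rewrite mulr_ge0 ?invr_ge0 ?sqr_ge0.
have QE w : Q w = \sum_j (score_sum n w j 0) ^+ 2.
  apply: eq_bigr => j _; rewrite /score_sum mxE exprMn exprVn sqr_sqrtr//.
  by rewrite summxE; congr (_ * _ ^+ 2); apply: eq_bigr => i _; rewrite /Z.
have K20 : 0 < K ^+ 2 by rewrite exprn_gt0.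
have /integrableP[mQ _] := iQ.
have := le_integral_abse P measurableT mQ K20.
rewrite setTI => hQ.
have sub : [set w | K < `|score_sum n w|] `<=`
    [set w | ((K ^+ 2)%:E <= `|(EFin \o Q) w|)%E].
  move=> w /= Kw; rewrite lee_fin ger0_norm// leNgt; apply/negP => Qw.
  have : `|score_sum n w| <= K.
    apply: norm_le_coord => [|j]; first exact: ltW.
    rewrite -(@ler_pXn2r _ 2)// ?nnegrE ?(ltW K0)// real_normK ?num_real//.
    apply: le_trans (ltW Qw); rewrite QE (bigD1 j)//= lerDl.
    by apply: sumr_ge0 => k _; exact: sqr_ge0.
  by rewrite leNgt Kw.
have mK := measurable_norm_gt K (score_sum_measurable n).
have mQK : measurable [set w | ((K ^+ 2)%:E <= `|(EFin \o Q) w|)%E].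
  rewrite -[X in measurable X]setTI.
  by apply: emeasurable_fun_c_infty => //; exact: measurableT_comp.
apply: le_trans (le_measure P (mem_set mK) (mem_set mQK) sub) _.
rewrite [leRHS](_ : _ = ((K ^+ 2)^-1%:E * (\tr (V eta0))%:E)%E); last first.
  by rewrite -EFinM mulrC.
rewrite lee_pdivlMl//; apply: le_trans hQ _.
rewrite -EQ /Rintegral fineK; last exact: integrable_fin_num.
by under eq_integral => w _ do rewrite /= ger0_norm//.
Qed.

(** Where [h] vanishes at an observation, the likelihood is identically zero and
    every parameter of [H] maximizes it; this event is negligible. *)
Lemma density_positive_ae : exists N : set W, [/\ measurable N, P N = 0%E &
  forall w, ~ N w -> forall i, 0 < h (X i w)].
Proof.
pose Z : set (borelType Omega) := [set x | h x = 0].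
have mZ : measurable Z.
  rewrite -[X in measurable X]setTI (_ : Z = h @^-1` [set 0])//.
  exact: (ef_h_meas fam).
have PZ i : P (X i @^-1` Z) = 0%E.
  rewrite -[LHS]/(distribution P (X i) Z) densityP// integral0_eq// => x Zx.
  by rewrite /exp_density Zx mul0r.
have mXZ i : measurable (X i @^-1` Z).
  by rewrite -[X in measurable X]setTI; exact: (measurable_funP (X i)).
exists (\bigcup_i (X i @^-1` Z)); split.
- exact: bigcupT_measurable.
- apply/negligibleP; first exact: bigcupT_measurable.
  apply: negligible_bigcup => i; exists (X i @^-1` Z).
  by split; [exact: mXZ|exact: PZ|].
move=> w Nw i; rewrite lt_neqAle (ef_h_ge0 fam) andbT; apply/eqP => hw.
by apply: Nw; exists i.
Qed.

End iid_sample.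

(** * Asymptotic linearity *)

Theorem proposition4p1 (R : realType) (Omega : pmetricType R)
    (hsep : separable Omega)
    (p : nat) (nu : {measure set (borelType Omega) -> \bar R})
    (H : set 'cV[R]_p) (h : Omega -> R) (T : Omega -> 'cV[R]_p)
    (A : 'cV[R]_p -> R)
    (hfam : exp_family nu H h T A)
    (hfisher : forall eta, H eta -> fisher_information A eta \in unitmx)
    (d : measure_display) (W : measurableType d) (P : probability W R)
    (eta0 : 'cV[R]_p) (heta0 : H eta0)
    (X : nat -> {RV P >-> borelType Omega})
    (hX : iid_with_density nu (exp_density h T A eta0) X)
    (etahat : nat -> {RV P >-> borelType 'cV[R]_p})
    (hmle : is_mle H h T A X etahat) :
  oP1 (P := P) (fun n w =>
    Num.sqrt n%:R *: ((etahat n w : 'cV[R]_p) - eta0)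
    - invmx (fisher_information A eta0) *m
        ((Num.sqrt n%:R)^-1 *:
           \sum_(i < n) (T (X i w) - gradient A eta0))).
Proof.
move=> eps eps0; rewrite /fisher_information.
rewrite (gradient_log_normalizer hfam heta0).
rewrite (hessian_log_normalizer hfam heta0).
have uV : exp_cov nu h T A eta0 \in unitmx.
  by rewrite -(hessian_log_normalizer hfam heta0); exact: hfisher.
set V := exp_cov _ _ _ _ _ in uV *; set g := exp_mean _ _ _ _ _.
pose r n w := Num.sqrt n%:R *: ((etahat n w : 'cV[R]_p) - eta0)
  - invmx V *m score_sum nu h T A eta0 X n w.
rewrite -[X in X @ _ --> _]/(fun n => P [set w | eps < `|r n w|]).
(* the probability of the event below is bounded by monotonicity of [P], which
   requires it to be measurable *)
have mr n : measurable_coords (r n).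
  apply: measurable_coordsB.
    apply: measurable_coordsZ; apply: measurable_coordsB; last first.
      exact: measurable_coords_cst.
    by apply: borel_measurable_coords; exact: measurable_funP.
  by apply: measurable_coords_mulmx; exact: (score_sum_measurable hfam).
have mE n := measurable_norm_gt eps (mr n).
have [N [mN PN hN]] := density_positive_ae hfam hX.
have trV0 : 0 <= \tr V.
  apply: sumr_ge0 => j _; have := exp_cov_psd hfam heta0 (delta_mx j 0).
  by rewrite dot_delta -colE mxE.
apply/fine_cvgP; split; first by near=> n; apply: fin_num_measure; exact: mE.
apply/cvgrPdist_le => e e0; rewrite /=.
(* chosen so that the tail bound [\tr V / K ^+ 2] is at most [e] *)
pose K := Num.sqrt (\tr V / e) + 1.
have K0 : 0 < K by rewrite ltr_wpDl// sqrtr_ge0.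
have KV : \tr V / K ^+ 2 <= e.
  rewrite ler_pdivrMr ?exprn_gt0// mulrC -ler_pdivrMr//.
  rewrite -[leLHS]sqr_sqrtr ?divr_ge0 ?(ltW e0)//.
  by rewrite lerXn2r ?nnegrE ?sqrtr_ge0 ?(ltW K0)// lerDl.
have [M hM] := maximizer_near_newton_step hfam heta0 uV (ltW K0) eps0.
near=> n.
have n0 : (0 < n)%N by near: n; exact: nbhs_infty_gt.
have Mn : M < Num.sqrt n%:R.
  apply: le_lt_trans (ler_norm M) _; rewrite -sqrtr_sqr ltr_sqrt ?ltr0n//.
  by near: n; exact: nbhs_infty_gtr.
rewrite sub0r normrN ger0_norm ?fine_ge0//.
rewrite -lee_fin fineK; last by apply: fin_num_measure; exact: mE.
set E := [set w | K < `|score_sum nu h T A eta0 X n w|].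
have mEK : measurable E.
  by apply: measurable_norm_gt; exact: (score_sum_measurable hfam).
have sub : [set w | eps < `|r n w|] `<=` E `|` N.
  move=> w /= ew; have [wN|wN] := pselect (N w); [by right|left].
  rewrite /E/= ltNge; apply/negP => Kw; move: ew; apply/negP; rewrite -leNgt.
  pose x := fun i : 'I_n => X i w : Omega.
  have hx i : 0 < h (x i) by exact: hN.
  pose tau := n%:R^-1 *: \sum_i T (x i).
  have tauE : tau = g + (Num.sqrt n%:R)^-1 *: score_sum nu h T A eta0 X n w.
    rewrite /score_sum scalerA -invfM -expr2 sqr_sqrtr// sumrB scalerBr.
    rewrite sumr_const card_ord -[g *+ n]scaler_nat scalerA mulVf ?scale1r.
      by rewrite addrC subrK.
    by rewrite pnatr_eq0 -lt0n.
  (* a maximizer exists, so that the estimator is one *)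
  have [[eta [He Hm]] near0] := hM n n0 Mn _ _ Kw tauE.
  have mx := hmle n w.
  have maxE eta' := @likelihood_maximizerE _ _ _ H h T A n x eta' n0 hx.
  have /maxE[Hhat Hmax] := mx (ex_intro _ eta ((maxE eta).2 (conj He Hm))).
  exact: near0.
apply: (@le_trans _ _ (P (E `|` N))).
  by apply: le_measure => //; rewrite inE//; exact: measurableU.
have hU : (P (E `|` N) <= P E + P N)%E by exact: measureU2.
rewrite PN adde0 in hU; apply: le_trans hU _.
apply: le_trans (score_sum_tail hfam heta0 hX n0 K0) _.
by rewrite lee_fin.
Unshelve. all: by end_near. Qed.
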